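(* The automorphism groups and switching automorphism groups of the minimal signed Petersen graphs and their negatives are, abstractly: $+P,-P$: $\operatorname{Aut}\cong\mathfrak S_5$, $\operatorname{SwAut}\cong\mathfrak S_5$; $P_1,-P_1$: $\mathfrak D_4$, $\mathfrak D_4$; $P_{2,2},-P_{2,2}$: $\mathfrak Z_2$, $\mathfrak V_4$; $P_{2,3},-P_{2,3}$: $\mathfrak D_4$, $\mathfrak D_4$; $P_{3,2},-P_{3,2}$: $\mathfrak S_3$, $\mathfrak A_5$; $P_{3,3},-P_{3,3}$: $\mathfrak S_4$, $\mathfrak S_5$. Explicitly, letting $i,j,k,l,m$ be the five elements of $\{1,\dots,5\}$ in any order, and writing $P_S$ for the signature of $P$ with negative edge set $S$ (the statements hold equally for $-P_S$): (1) $\operatorname{Aut}(\pm P)=\mathfrak S_{\{1,\dots,5\}}$ and $\operatorname{SwAut}(\pm P)=\{\bar\varepsilon\}\times\mathfrak S_{\{1,\dots,5\}}$; (2) for $S=\{v_{ij}v_{kl}\}$: $\operatorname{Aut}=\langle(ij),(ikjl)\rangle$ and $\operatorname{SwAut}=\{\bar\varepsilon\}\times\langle(ij),(ikjl)\rangle$; (3) for $S=\{v_{il}v_{jm},v_{kl}v_{im}\}$: $\operatorname{Aut}=\langle(jk)(lm)\rangle$ and $\operatorname{SwAut}=\langle\bar\varepsilon(jk)(lm),\ \bar\zeta_{\{v_{jm},v_{kl}\}}(jl)(km)\rangle$; (4) for $S=\{v_{ik}v_{jl},v_{il}v_{jk}\}$: $\operatorname{Aut}=\langle(ij),(ikjl)\rangle$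 and $\operatorname{SwAut}=\{\bar\varepsilon\}\times\langle(ij),(ikjl)\rangle$; (5) for $S=\{v_{il}v_{jm},v_{kl}v_{im},v_{jl}v_{km}\}$: $\operatorname{Aut}=(\mathfrak S_{\{i,j,k\}}\times\mathfrak S_{\{l,m\}})^+$ and $\bar p_A(\operatorname{SwAut})$ is the alternating group $\mathfrak A_5$ of even permutations of $\{1,\dots,5\}$; (6) for $S=\{v_{ij}v_{kl},v_{ik}v_{jl},v_{il}v_{jk}\}$: $\operatorname{Aut}=\mathfrak S_{\{i,j,k,l\}}$ and $\operatorname{SwAut}=\mathfrak S_{\{i,j,k,l\}}\cup\bigcup_{p\in\{i,j,k,l\}}\bar\zeta_{N[v_{pm}]}(pm)\,\mathfrak S_{\{i,j,k,l\}}$.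
   Context: The Petersen graph $P$ has vertices $v_{ij}$ for the 2-element subsets $\{i,j\}\subseteq\{1,\dots,5\}$, with $v_{ij}v_{kl}$ an edge iff $\{i,j\}\cap\{k,l\}=\emptyset$; a permutation $\pi$ of $\{1,\dots,5\}$ acts on $P$ by $v_{ab}\mapsto v_{a^\pi b^\pi}$, and this identifies $\operatorname{Aut}P$ with $\mathfrak S_5$. Permutations act on the right. $N[v]$ is the closed neighborhood of $v$. For $X\subseteq V$, $\zeta_X(v)=-$ if $v\in X$ and $+$ otherwise; $\varepsilon$ is the all-positive switching function; $\sigma^\zeta(vw)=\zeta(v)\sigma(vw)\zeta(w)$; $\sigma^\alpha(v^\alpha w^\alpha)=\sigma(vw)$ and $\zeta^\alpha(v^\alpha)=\zeta(v)$ for $\alpha\in\operatorname{Aut}P$. $\operatorname{SwAut}P$ is the semidirect product $\{+,-\}^V\rtimes\operatorname{Aut}P$ (product $\zeta\alpha\cdot\eta\beta=\zeta\eta^{\alpha^{-1}}\alpha\beta$) modulo $\{\pm\varepsilon\}$, with elements $\bar\zeta\alpha$; for a signature $\sigma$, $\operatorname{SwAut}(P,\sigma)=\{\bar\zeta\alpha:(\sigma^\zeta)^\alpha=\sigma\}$, $\operatorname{Aut}(P,\sigma)$ is the group of sign-preserving automorphisms (identified with $\{\bar\varepsilon\alpha\}$), and $\bar p_A:\bar\zeta\alpha\mapsto\alpha$. $\mathfrak G^+$ denotes the even permutations in $\mathfrak G$; $\mathfrak D_4$ is the dihedral group of order 8, $\mathfrak Z_2$ cyclic of order 2, $\mathfrak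 V_4$ the Klein four-group. Named signatures: $+P$ all positive, $-P$ all negative; $P_1$ one negative edge; $P_{2,2}$/$P_{2,3}$ two negative edges at distance 2/3 (edge distance in the line graph; disjoint edges of $P$ have distance 2 if joined by an edge, 3 otherwise); $P_{3,2}$ three negative edges alternate on a 6-cycle; $P_{3,3}$ three negative edges pairwise at distance 3. The sets $S$ in (2)–(6) are instances of $P_1,P_{2,2},P_{2,3},P_{3,2},P_{3,3}$ respectively. *)

(* Defs.v *)
From HB Require Import structures.
From mathcomp Require Import all_boot all_fingroup zmodp all_solvable.

Set Implicit Arguments.
Unset Strict Implicit.
Unset Printing Implicit Defensive.

Import GroupScope.

(** * The Petersen graph

    The ground set {1, ..., 5} is represented by ['I_5] = {0, ..., 4}. *)

Record vertex := Vertex { vset :> {set 'I_5}; _ : #|vset| == 2 }.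
HB.instance Definition _ := [isSub for vset].
HB.instance Definition _ := [Finite of vertex by <:].

Lemma vertex0_subproof : #|[set ord0; ord_max : 'I_5]| == 2.
Proof. by rewrite cards2. Qed.

(* [vtx i j] is v_{ij} for i != j; for i = j it is a meaningless default. *)
Definition vtx (i j : 'I_5) : vertex :=
  insubd (Vertex vertex0_subproof) [set i; j].

Lemma vset_vtx i j : i != j -> vset (vtx i j) = [set i; j].
Proof.
by move=> ne_ij; rewrite [LHS]insubdK // unfold_in /= cards2 ne_ij.
Qed.

Definition adj : rel vertex := fun u w => vset u :&: vset w == set0.

Lemma adj_sym : symmetric adj.
Proof. by move=> u w; rewrite /adj setIC. Qed.

Lemma adj_irr u : adj u u = false.
Proof.
by apply/negP; rewrite /adj setIid => /eqP u0; case: u u0 => A /= /[swap]->;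
  rewrite cards0.
Qed.

Definition is_edge (e : {set vertex}) :=
  [exists u, exists w, adj u w && (e == [set u; w])].

Lemma is_edgeP e :
  reflect (exists u w, adj u w /\ e = [set u; w]) (is_edge e).
Proof.
apply: (iffP existsP) => [[u /existsP[w /andP[uw /eqP->]]]|[u [w [uw ->]]]].
  by exists u, w.
by exists u; apply/existsP; exists w; rewrite uw eqxx.
Qed.

Lemma adj_is_edge u w : adj u w -> is_edge [set u; w].
Proof. by move=> uw; apply/is_edgeP; exists u, w. Qed.

Record edge := Edge { eset :> {set vertex}; _ : is_edge eset }.
HB.instance Definition _ := [isSub for eset].
HB.instance Definition _ := [Finite of edge by <:].

Definition closed_nbhd (v : vertex) : {set vertex} :=
  [set w | (w == v) || adj v w].

(* Edge distance is distance in the line graph. *)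
Definition line_adj : rel edge :=
  fun e f => (e != f) && (eset e :&: eset f != set0).

Definition edge_dist (e f : edge) (n : nat) : Prop :=
  (exists p, [/\ path line_adj e p, last e p = f & size p = n]) /\
  (forall p, path line_adj e p -> last e p = f -> n <= size p).

(** * Automorphisms of the Petersen graph

    Permutations act on the right: [(s * t) x] is [t (s x)]. *)

Definition AutP : {set {perm vertex}} :=
  [set a : {perm vertex} | [forall u, forall w, adj (a u) (a w) == adj u w]].

Lemma AutPP (a : {perm vertex}) :
  reflect (forall u w, adj (a u) (a w) = adj u w) (a \in AutP).
Proof.
rewrite inE; apply: (iffP forallP) => [h u w|h u].
  by move/forallP: (h u) => /(_ w)/eqP.
by apply/forallP=> w; rewrite h.
Qed.

Lemma AutP_group_set : group_set AutP.
Proof.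
apply/group_setP; split=> [|a b /AutPP ha /AutPP hb].
  by apply/AutPP=> u w; rewrite !perm1.
by apply/AutPP=> u w; rewrite !permM hb ha.
Qed.
Canonical AutP_group := Group AutP_group_set.

Lemma vact_subproof (s : 'S_5) (v : vertex) : #|s @: vset v| == 2.
Proof. by case: v => A hA; rewrite card_imset //; apply: perm_inj. Qed.

Definition vact (s : 'S_5) (v : vertex) : vertex := Vertex (vact_subproof s v).

Lemma vact_inj s : injective (vact s).
Proof.
move=> u w /(congr1 vset) /= e; apply/val_inj/setP=> x /=.
by rewrite -(mem_imset (vset u) x (@perm_inj _ s)) e
           (mem_imset _ _ (@perm_inj _ s)).
Qed.

(* The permutation v_{ab} |-> v_{a^s b^s} of the vertices. *)
Definition pact (s : 'S_5) : {perm vertex} := perm (@vact_inj s).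

Lemma pactE s i j : i != j -> pact s (vtx i j) = vtx (s i) (s j).
Proof.
move=> ne_ij; apply: val_inj; rewrite permE /= !vset_vtx //.
  by rewrite imsetU !imset_set1.
by rewrite (inj_eq perm_inj).
Qed.

Lemma pactM : {morph pact : s t / s * t}.
Proof.
move=> s t; apply/permP=> v; rewrite permM !permE; apply: val_inj => /=.
by rewrite -imset_comp; apply: eq_imset => x; rewrite permM.
Qed.
Canonical pact_morphism := @Morphism _ _ setT pact (in2W pactM).

Lemma pact_AutP s : pact s \in AutP.
Proof.
apply/AutPP=> u w; rewrite /adj !permE /= -imsetI; last exact: in2W perm_inj.
by rewrite imset_eq0.
Qed.

(* The 4-cycle sending a to b, b to c, c to d and d to a. *)
Definition cyc4 (a b c d : 'I_5) : 'S_5 := tperm a b * tperm a c * tperm a d.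

Lemma cyc4E a b c d : uniq [:: a; b; c; d] ->
  [/\ cyc4 a b c d a = b, cyc4 a b c d b = c,
      cyc4 a b c d c = d & cyc4 a b c d d = a].
Proof.
rewrite /= !inE !negb_or andbT => /andP[/and3P[ab ac ad] /andP[/andP[bc bd] cd]].
have [[ba ca da cb db] dc] :
    [/\ b != a, c != a, d != a, c != b & d != b] /\ d != c.
  by split; [split|]; rewrite eq_sym.
have E := (eqxx, negPf ab, negPf ac, negPf ad, negPf bc, negPf bd, negPf cd,
           negPf ba, negPf ca, negPf da, negPf cb, negPf db, negPf dc).
by rewrite /cyc4 !permM; split; do 3!rewrite permE /= ?E /=; rewrite ?E.
Qed.

(* The permutations of {1, ..., 5} that fix every element outside X. *)
Definition SymOn (X : {set 'I_5}) : {set 'S_5} := perm.Sym X.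

Definition even_part (G : {set 'S_5}) : {set 'S_5} :=
  [set s in G | ~~ odd_perm s].

(** * Signatures and switching

    The sign group {+, -} is [bool], with [true] for -, [false] for + and
    [addb] (written [(+)]) for multiplication. *)

Definition signature := {ffun edge -> bool}.
Definition switching := {ffun vertex -> bool}.

(* P_S, with negative edge set S. *)
Definition sigP (S : {set {set vertex}}) : signature :=
  [ffun e : edge => eset e \in S].
Definition sigN (sg : signature) : signature := [ffun e => ~~ sg e].
Definition pmsig (tau sg : signature) : Prop := sg = tau \/ sg = sigN tau.

Definition zeta (X : {set vertex}) : switching := [ffun v => v \in X].
Definition eps : switching := zeta set0.
Definition negeps : switching := zeta setT.

(* The value of a signature at a vertex set; + if this is not an edge. *)
Definition sig_at (sg : signature) (e : {set vertex}) : bool :=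
  if insub e is Some e' then sg e' else false.

Lemma sig_atE sg (e : edge) : sig_at sg (eset e) = sg e.
Proof. by rewrite /sig_at valK. Qed.

(* sigma^zeta; the product is over the two ends of e. *)
Definition switch (sg : signature) (z : switching) : signature :=
  [ffun e : edge => sg e (+) \big[addb/false]_(v in eset e) z v].

Lemma switchE sg z u w : adj u w ->
  sig_at (switch sg z) [set u; w] = z u (+) sig_at sg [set u; w] (+) z w.
Proof.
move=> uw; have ne_uw : u != w.
  by apply: contraTneq uw => ->; rewrite adj_irr.
pose e := Edge (adj_is_edge uw).
rewrite !(sig_atE _ e : sig_at _ [set u; w] = _) ffunE /= big_setU1 ?inE //.
by rewrite big_set1 addbA (addbC (sg e)).
Qed.

(* sigma^alpha and zeta^alpha, for alpha in Aut P. *)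
Definition sig_act (sg : signature) (a : {perm vertex}) : signature :=
  [ffun e : edge => sig_at sg (a^-1 @: eset e)].

Lemma sig_actE sg a u w : a \in AutP -> adj u w ->
  sig_at (sig_act sg a) [set a u; a w] = sig_at sg [set u; w].
Proof.
move=> /AutPP ha uw; have uw' : adj (a u) (a w) by rewrite ha.
rewrite -[LHS]/(sig_at _ (eset (Edge (adj_is_edge uw')))) sig_atE ffunE /=.
by rewrite imsetU !imset_set1 !permK.
Qed.

Definition sw_act (z : switching) (a : {perm vertex}) : switching :=
  [ffun v => z (a^-1 v)].

Lemma sw_actE z a v : sw_act z a (a v) = z v.
Proof. by rewrite ffunE permK. Qed.

(** * The switching automorphism group *)

(* The pair [SwPerm z a] is zeta alpha. *)
Record swperm := SwPerm { sw_of : switching; perm_of : {perm vertex} }.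

Definition pair_of_swperm x := (sw_of x, perm_of x).
Definition swperm_of_pair x := SwPerm x.1 x.2.
Lemma pair_of_swpermK : cancel pair_of_swperm swperm_of_pair.
Proof. by case. Qed.
HB.instance Definition _ := Finite.copy swperm (can_type pair_of_swpermK).

Definition sw_mul (z y : switching) : switching := [ffun v => z v (+) y v].

Definition swperm_one := SwPerm eps 1.
Definition swperm_mul (x y : swperm) :=
  SwPerm (sw_mul (sw_of x) (sw_act (sw_of y) (perm_of x)^-1))
         (perm_of x * perm_of y).
Definition swperm_inv (x : swperm) :=
  SwPerm (sw_act (sw_of x) (perm_of x)) (perm_of x)^-1.

Lemma swperm_mulA : associative swperm_mul.
Proof.
move=> [z a] [y b] [x c]; congr SwPerm; last exact: mulgA.
by apply/ffunP=> v; rewrite !ffunE /= !invgK permM addbA.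
Qed.

Lemma swperm_mul1 : left_id swperm_one swperm_mul.
Proof.
case=> z a; congr SwPerm; last exact: mul1g.
by apply/ffunP=> v; rewrite !ffunE inE invgK perm1.
Qed.

Lemma swperm_mulV : left_inverse swperm_one swperm_inv swperm_mul.
Proof.
case=> z a; congr SwPerm; last exact: mulVg.
by apply/ffunP=> v; rewrite !ffunE inE invgK addbb.
Qed.

HB.instance Definition _ := Finite_isGroup.Build swperm
  swperm_mulA swperm_mul1 swperm_mulV.

Lemma swpermM z a y b :
  SwPerm z a * SwPerm y b = SwPerm (sw_mul z (sw_act y a^-1)) (a * b).
Proof. by []. Qed.

(* The semidirect product of {+,-}^V and Aut P. *)
Definition swAutP : {set swperm} := [set x | perm_of x \in AutP].

Lemma mem_swAutP x : (x \in swAutP) = (perm_of x \in AutP).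
Proof. exact: in_set. Qed.

Lemma swAutP_group_set : group_set swAutP.
Proof.
apply/group_setP; split=> [|x y]; rewrite !mem_swAutP; first exact: group1.
exact: (@groupM _ AutP_group).
Qed.
Canonical swAutP_group := Group swAutP_group_set.

(* The normal subgroup {eps, - eps}. *)
Definition pmeps : {set swperm} := [set SwPerm eps 1; SwPerm negeps 1].

Lemma pmeps_group_set : group_set pmeps.
Proof.
apply/group_setP; split=> [|x y]; first by rewrite !inE eqxx.
have E : sw_mul negeps (sw_act negeps 1^-1) = eps.
  by apply/ffunP=> v; rewrite !ffunE !inE.
case/set2P=> -> /set2P[]->; rewrite ?mul1g ?mulg1 ?set21 ?set22 //.
by rewrite swpermM E mul1g set21.
Qed.
Canonical pmeps_group := Group pmeps_group_set.

Lemma pmeps_norm : [set: swperm] \subset 'N(pmeps).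
Proof.
apply/subsetP=> -[z a] _; rewrite inE; apply/subsetP=> y /imsetP[w].
case/set2P=> -> ->; first by rewrite conj1g group1.
suff E : commute (SwPerm negeps 1) (SwPerm z a).
  by rewrite conjgE E mulKg set22.
rewrite /commute !swpermM mul1g mulg1; congr SwPerm.
by apply/ffunP=> v; rewrite !ffunE !inE ?invgK ?invg1 ?perm1 addbC.
Qed.

Lemma pmeps_normal : pmeps <| swAutP.
Proof.
rewrite /normal (subset_trans (subsetT _) pmeps_norm) andbT.
by apply/subsetP=> x /set2P[]->; rewrite mem_swAutP group1.
Qed.

Definition SwAutP : {set coset_of pmeps} := swAutP / pmeps.

(* The element of SwAut P written as zeta-bar alpha. *)
Definition bar (z : switching) (a : {perm vertex}) : coset_of pmeps :=
  coset pmeps (SwPerm z a).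

(* For a set G of automorphisms of P, the set of all eps-bar alpha with alpha
   in G, written {eps-bar} x G, or just G. *)
Definition eps_bar (G : {set {perm vertex}}) : {set coset_of pmeps} :=
  [set bar eps a | a in G].

(* The projection zeta-bar alpha |-> alpha. *)
Definition pA (x : coset_of pmeps) : {perm vertex} := perm_of (repr x).

Lemma pA_bar z a : pA (bar z a) = a.
Proof.
rewrite /pA; move: (repr _) (mem_repr_coset (bar z a)) => x.
rewrite val_coset ?(subsetP pmeps_norm) ?inE // => /rcosetP[y].
by case/set2P=> -> -> /=; rewrite mul1g.
Qed.

(** * Automorphisms and switching automorphisms of a signature *)

Definition Aut_sig (sg : signature) : {set {perm vertex}} :=
  [set a in AutP | sig_act sg a == sg].

Definition swstab (sg : signature) : {set swperm} :=
  [set x in swAutP | sig_act (switch sg (sw_of x)) (perm_of x) == sg].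

Definition SwAut_sig (sg : signature) : {set coset_of pmeps} :=
  [set bar (sw_of x) (perm_of x) | x in swstab sg].

Lemma sig_eqP (sg tau : signature) :
  (forall u w, adj u w -> sig_at sg [set u; w] = sig_at tau [set u; w]) ->
  sg = tau.
Proof.
move=> E; apply/ffunP=> -[e he]; rewrite -!sig_atE /=.
by case/is_edgeP: (he) => u [w [uw ->]]; apply: E.
Qed.

Lemma swact_mul sg x y : x \in swAutP -> y \in swAutP ->
  sig_act (switch sg (sw_of (x * y))) (perm_of (x * y)) =
  sig_act (switch (sig_act (switch sg (sw_of x)) (perm_of x)) (sw_of y))
    (perm_of y).
Proof.
case: x y => [z a] [y b]; rewrite swpermM !mem_swAutP /= => ha hb.
apply: sig_eqP => u w; rewrite -[u](permKV (a * b)) -[w](permKV (a * b)).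
move: (_ u) (_ w) => {}u {}w; have /AutPP-> : a * b \in AutP by rewrite groupM.
move=> uw; rewrite sig_actE ?groupM // switchE // !permM.
have uw' : adj (a u) (a w) by move/AutPP: ha => ->.
rewrite sig_actE // switchE // sig_actE // switchE // !ffunE invgK.
by rewrite !addbA (addbC (z u)) -!addbA (addbC (y _)).
Qed.

Lemma swact1 sg : sig_act (switch sg eps) 1 = sg.
Proof.
apply: sig_eqP => u w uw; rewrite -[in LHS](perm1 u) -[in LHS](perm1 w).
by rewrite sig_actE ?group1 // switchE // !ffunE !inE addbF.
Qed.

Lemma swstab_group_set sg : group_set (swstab sg).
Proof.
apply/group_setP; split=> [|x y]; first by apply/setIdP; rewrite group1 /= swact1.
move=> /setIdP[hx /eqP Ex] /setIdP[hy /eqP Ey]; apply/setIdP.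
by split; [apply: groupM | rewrite swact_mul // Ex Ey].
Qed.
Canonical swstab_group sg := Group (swstab_group_set sg).

Lemma switch_eps sg : switch sg eps = sg.
Proof.
by apply/ffunP=> e; rewrite ffunE big1 ?addbF // => v _; rewrite ffunE inE.
Qed.

Lemma Aut_sig_group_set sg : group_set (Aut_sig sg).
Proof.
have E a : (a \in Aut_sig sg) = (SwPerm eps a \in swstab sg).
  by rewrite [LHS]in_set [RHS]in_set mem_swAutP /= switch_eps.
apply/group_setP; split=> [|a b]; rewrite !E; first exact: group1.
have -> : SwPerm eps (a * b) = SwPerm eps a * SwPerm eps b.
  by rewrite swpermM; congr SwPerm; apply/ffunP=> v; rewrite !ffunE !inE.
exact: groupM.
Qed.
Canonical Aut_sig_group sg := Group (Aut_sig_group_set sg).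

Lemma SwAut_sigE sg : SwAut_sig sg = swstab sg / pmeps.
Proof.
apply/esym; rewrite [LHS]morphimEsub ?(subset_trans (subsetT _) pmeps_norm) //.
by apply: eq_imset; case.
Qed.

Lemma SwAut_sig_group_set sg : group_set (SwAut_sig sg).
Proof. by rewrite SwAut_sigE groupP. Qed.
Canonical SwAut_sig_group sg := Group (SwAut_sig_group_set sg).

Lemma SwAut_sig_sub sg : SwAut_sig sg \subset SwAutP.
Proof. by rewrite SwAut_sigE quotientS //; apply/subsetP=> x /setIdP[]. Qed.

(** * The minimal signed Petersen graphs *)

Definition plusP : signature := sigP set0.

Definition is_P1 (sg : signature) : Prop :=
  exists e : edge, sg = sigP [set eset e].

Definition is_P22 (sg : signature) : Prop :=
  exists e f : edge, sg = sigP [set eset e; eset f] /\ edge_dist e f 2.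

Definition is_P23 (sg : signature) : Prop :=
  exists e f : edge, sg = sigP [set eset e; eset f] /\ edge_dist e f 3.

Definition is_P32 (sg : signature) : Prop :=
  exists a b c d e f : vertex, ucycle adj [:: a; b; c; d; e; f] /\
    sg = sigP [set [set a; b]; [set c; d]; [set e; f]].

Definition is_P33 (sg : signature) : Prop :=
  exists e f g : edge, sg = sigP [set eset e; eset f; eset g] /\
    [/\ edge_dist e f 3, edge_dist e g 3 & edge_dist f g 3].

(* Main.v *)
(** Every automorphism of P comes from a unique permutation of {1, ..., 5}: P is
    3-arc-transitive under such permutations, and an automorphism fixing a 3-arc
    fixes every vertex, because vertices are successively determined by their
    adjacencies to fixed ones.  The projection to Aut P is injective on
    SwAut (P, sigma), since a switching function that preserves a signature of the
    connected graph P is constant; so SwAut (P, sigma) is known once its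
    projection is.  Sign products around the twelve 5-cycles are switching
    invariants, which bounds the projection from above; explicit switching
    functions for generators bound it from below.  Relative to a labelling of the
    ground set by i, j, k, l, m everything reduces to computations on the 120
    permutations of five letters.  The switching automorphism groups of the two
    edges at distance 2 and of the alternating hexagon share the element
    zeta_{v_jm, v_kl} (jl)(km). *)

Require Import Defs.
From mathcomp Require Import all_boot all_fingroup zmodp all_solvable.
Import GroupScope.

Set Implicit Arguments.
Unset Strict Implicit.
Unset Printing Implicit Defensive.

(** * Permutations as lists *)

(* Explicit ordinals, unlike [inord], reduce under [vm_compute]. *)
Notation o0 := (@Ordinal 5 0 isT).
Notation o1 := (@Ordinal 5 1 isT).
Notation o2 := (@Ordinal 5 2 isT).
Notation o3 := (@Ordinal 5 3 isT).
Notation o4 := (@Ordinal 5 4 isT).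

Definition o5 : seq 'I_5 := [:: o0; o1; o2; o3; o4].
Arguments o5 : simpl never.

Lemma mem_o5 (a : 'I_5) : a \in o5.
Proof. by rewrite -(mem_map val_inj); case: a => [[|[|[|[|[|]]]]]]. Qed.

Fixpoint tuples5 (n : nat) : seq (seq 'I_5) :=
  if n is n'.+1 then [seq a :: x | a <- o5, x <- tuples5 n'] else [:: [::]].

Definition codes : seq (seq 'I_5) := [seq x <- tuples5 5 | uniq x].

(* A permutation s of 'I_5 is coded by the list [s 0; ...; s 4]. *)
Definition capp (x : seq 'I_5) (a : 'I_5) : 'I_5 := nth o0 x a.
Definition code (s : 'S_5) : seq 'I_5 := [seq s a | a <- o5].

Lemma capp_code s a : capp (code s) a = s a.
Proof. by move: (mem_o5 a); rewrite !inE => /or4P[|||/orP[]] /eqP->. Qed.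

Lemma code_inj : injective code.
Proof. by move=> s r e; apply/permP=> a; rewrite -!capp_code e. Qed.

Lemma mem_tuples5 (x : seq 'I_5) : x \in tuples5 (size x).
Proof.
by elim: x => // a x IH; apply: (allpairs_f cons) => //; apply: mem_o5.
Qed.

Lemma mem_codes (x : seq 'I_5) : size x = 5 -> uniq x -> x \in codes.
Proof.
by move=> sx ux; rewrite mem_filter ux; move: (mem_tuples5 x); rewrite sx.
Qed.

Lemma code_codes s : code s \in codes.
Proof. by apply: mem_codes; rewrite ?map_inj_uniq //; apply: perm_inj. Qed.

(** Turns a statement about every permutation into a boolean check on the 120 codes, which
    evaluation decides. *)
Lemma all_codes (P : pred (seq 'I_5)) : all P codes -> forall s, P (code s).
Proof. by move/allP=> h s; apply/h/code_codes. Qed.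

Lemma size_tuples5 n x : x \in tuples5 n -> size x = n.
Proof.
elim: n x => [|n IH] x; first by rewrite inE => /eqP->.
by case/allpairsPdep=> a [y [_ /IH<- ->]].
Qed.

Lemma codes_sizeE x : x \in codes -> size x = 5 /\ uniq x.
Proof.
by rewrite mem_filter => /andP[ux /size_tuples5].
Qed.

Lemma codeP x : x \in codes -> {s | code s = x}.
Proof.
case/codes_sizeE=> sx ux.
have inj : injective (capp x).
  move=> a b /eqP; rewrite /capp nth_uniq ?sx // => /eqP.
  exact: val_inj.
exists (perm inj); apply: (@eq_from_nth _ o0) => [|n hn]; rewrite ?size_map ?sx //.
rewrite (nth_map o0) // permE /capp; congr nth.
by move: n hn => [|[|[|[|[|]]]]].
Qed.

Lemma card_code (Q : pred (seq 'I_5)) :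
  #|[set s | Q (code s)]| = count Q codes.
Proof.
rewrite cardE -(size_map code) -size_filter; apply/perm_size/uniq_perm.
- by rewrite map_inj_uniq ?enum_uniq //; apply: code_inj.
- by rewrite filter_uniq //; vm_compute.
move=> x; rewrite mem_filter; apply/mapP/andP => [[s]|[Qx /codeP[s sx]]].
  by rewrite mem_enum inE => Qs ->; rewrite code_codes.
by exists s; rewrite // mem_enum inE sx.
Qed.

(** The factor x acts first, in accordance with the right action. *)
Definition ccomp (x y : seq 'I_5) : seq 'I_5 := [seq capp y a | a <- x].

Lemma codeM s r : code (s * r) = ccomp (code s) (code r).
Proof.
by rewrite /ccomp -map_comp; apply: eq_map => a /=; rewrite capp_code permM.
Qed.

Definition ctperm (a b : 'I_5) : seq 'I_5 :=
  [seq if c == a then b else if c == b then a else c | c <- o5].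

Lemma code_tperm a b : code (tperm a b) = ctperm a b.
Proof. by apply: eq_map => c; rewrite permE. Qed.

Definition ccyc4 a b c d := ccomp (ccomp (ctperm a b) (ctperm a c)) (ctperm a d).

Lemma code_cyc4 a b c d : code (cyc4 a b c d) = ccyc4 a b c d.
Proof. by rewrite /cyc4 !codeM !code_tperm. Qed.

Lemma code1 : code 1 = o5.
Proof. by apply: map_id_in => a _; rewrite perm1. Qed.

(* Codes of the products of at most n elements coded in gs. *)
Definition words (n : nat) (gs : seq (seq 'I_5)) : seq (seq 'I_5) :=
  iter n (fun W => undup (W ++ [seq ccomp w g | w <- W, g <- gs])) [:: o5].

(** Soundness of the word enumeration. That n is large enough to reach every element is confirmed by
    computation at each use. *)
Lemma words_gen n (gs : seq 'S_5) (A : {set 'S_5}) s :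
  {subset gs <= A} -> code s \in words n (map code gs) -> s \in <<A>>.
Proof.
move=> gsA; suff H x : x \in words n (map code gs) ->
    exists2 r, r \in <<A>> & code r = x.
  by case/H=> r hr /code_inj <-.
elim: n x => [|n IH] x.
  by rewrite inE => /eqP->; exists 1; rewrite ?group1 ?code1.
rewrite [words _ _]/= mem_undup mem_cat => /orP[/IH//|/allpairsP[[w g] /= [+ + ->]]].
case/IH=> r hr <- /mapP[q hq ->].
rewrite -codeM; exists (r * q); first by apply: groupM => //; apply/mem_gen/gsA.
by [].
Qed.

(** * Labelled vertices and Aut P *)

Lemma eq_set2 (T : finType) (a b c d : T) :
  ([set a; b] == [set c; d]) = ((a == c) && (b == d)) || ((a == d) && (b == c)).
Proof.
apply/eqP/orP=> [e|[]/andP[/eqP-> /eqP->] //]; last exact: setUC.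
have := set21 a b; have := set22 a b; have := set21 c d; have := set22 c d.
rewrite -{1 2}e {3 4}e !inE.
do 4!case/orP=> /eqP ?; subst; rewrite ?eqxx /=; by [left|right].
Qed.

Definition eqp (p q : 'I_5 * 'I_5) :=
  ((p.1 == q.1) && (p.2 == q.2)) || ((p.1 == q.2) && (p.2 == q.1)).

Definition disj (p q : 'I_5 * 'I_5) :=
  [&& p.1 != q.1, p.1 != q.2, p.2 != q.1 & p.2 != q.2].

Definition vpair (p : 'I_5 * 'I_5) := p.1 != p.2.

(** Increasing pairs list each vertex once. Since [mapp] may leave this list, vertices are compared
    through [eqp]. *)
Definition pairs : seq ('I_5 * 'I_5) :=
  [seq p : 'I_5 * 'I_5 <- [seq (a, b) | a <- o5, b <- o5] | (p.1 < p.2)%N].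

(* The vertex v_{ab} when the ground set is labelled through t: the letters
   i, j, k, l, m of the paper are t o0, ..., t o4. *)
Definition vlab (t : 'S_5) (p : 'I_5 * 'I_5) : vertex := vtx (t p.1) (t p.2).

Lemma vset_vlab t p : vpair p -> vset (vlab t p) = [set t p.1; t p.2].
Proof. by move=> hp; rewrite vset_vtx // (inj_eq perm_inj). Qed.

Lemma eq_vlab t p q : vpair p -> vpair q -> (vlab t p == vlab t q) = eqp p q.
Proof.
by move=> hp hq; rewrite -val_eqE /= !vset_vlab // eq_set2 !(inj_eq perm_inj).
Qed.

Lemma adj_vlab t p q : vpair p -> vpair q -> adj (vlab t p) (vlab t q) = disj p q.
Proof.
move=> hp hq; rewrite /adj !vset_vlab // setI_eq0 disjoints_subset subUset !sub1set.
by rewrite !inE !negb_or !(inj_eq perm_inj) -andbA.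
Qed.

Lemma vpair_pairs p : p \in pairs -> vpair p.
Proof. by rewrite mem_filter => /andP[h _]; rewrite /vpair neq_ltn h. Qed.

Lemma vlab_surj t v : exists2 p, p \in pairs & v = vlab t p.
Proof.
have /cards2P[a [b [ab e]]] : #|vset v| == 2 by case: v.
have P c d : (c, d) \in [seq (a, b) | a <- o5, b <- o5].
  by apply: (allpairs_f (fun a b : 'I_5 => (a, b))); apply: mem_o5.
have vE c d : [set a; b] = [set t c; t d] -> c != d -> v = vlab t (c, d).
  by move=> e' cd; apply: val_inj; rewrite /= e e' vset_vlab.
rewrite -[a](permKV t) -[b](permKV t) in vE ab.
rewrite (inj_eq perm_inj) in ab.
case: (ltngtP (t^-1 a) (t^-1 b)) => [h|h|/val_inj h]; last by rewrite h eqxx in ab.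
  by exists (t^-1 a, t^-1 b); [rewrite mem_filter h P | apply: vE].
exists (t^-1 b, t^-1 a); first by rewrite mem_filter h P.
by apply: vE; rewrite 1?setUC // eq_sym.
Qed.

Definition mapp (x : seq 'I_5) (p : 'I_5 * 'I_5) := (capp x p.1, capp x p.2).

(** In the labelling t, the permutation s acts on labels as [s ^ t^-1], which sends a to
    $t^{-1}(s(t(a)))$. This is why conjugates by t occur throughout. *)
Lemma pact_vlab s t p : vpair p ->
  pact s (vlab t p) = vlab t (mapp (code (s ^ t^-1)) p).
Proof.
move=> hp; rewrite pactE ?(inj_eq perm_inj) // /vlab /mapp !capp_code /=.
by rewrite !conjgE invgK !permM !permKV.
Qed.

Lemma vpair_mapp s p : vpair p -> vpair (mapp (code s) p).
Proof. by rewrite /vpair /= !capp_code (inj_eq perm_inj). Qed.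

(** A letter is recovered from two vertices containing it: s a lies in both {r a, r b} and {r a, r
    c}, and r b differs from r c. *)
Lemma pact_inj : injective pact.
Proof.
move=> s r e; apply/permP=> a.
have E b : a != b -> [set s a; s b] = [set r a; r b].
  move=> ab; rewrite -!vset_vtx ?(inj_eq perm_inj) //.
  by rewrite -!pactE // e.
have [b [c [ab ac bc]]] : exists b c : 'I_5, [/\ a != b, a != c & b != c].
  by move: a {E}; case=> [[|[|[|[|[|]]]]]] // i;
    [exists o1, o2|exists o0, o2|exists o0, o1|exists o0, o1|exists o0, o1].
have := set21 (s a) (s b); have := set21 (s a) (s c); rewrite !E // !inE.
case/orP=> /eqP // h; case/orP=> /eqP // h'.
by move/eqP: bc; case; apply: (@perm_inj _ r); rewrite -h -h'.
Qed.

Lemma injm_pact : 'injm pact.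
Proof. by apply/injmP=> s r _ _; apply: pact_inj. Qed.
Lemma vlab_code t p : vlab t p = vlab 1 (mapp (code t) p).
Proof. by rewrite /vlab !perm1 /mapp !capp_code. Qed.

Lemma has_codes (P : pred (seq 'I_5)) : has P codes -> exists t, P (code t).
Proof. by case/hasP=> x /codeP[t <-]; exists t. Qed.

Lemma eqp_vlab t p q : vpair p -> vpair q -> eqp p (mapp (code t) q) ->
  vlab 1 p = vlab t q.
Proof.
by move=> hp hq e; rewrite (vlab_code t); apply/eqP; rewrite eq_vlab ?vpair_mapp.
Qed.

(** * Automorphisms of P are permutations of the letters *)

Definition nbrs p := [seq q <- pairs | disj p q].

Lemma mem_nbrs p q : q \in pairs -> (q \in nbrs p) = disj p q.
Proof. by move=> hq; rewrite mem_filter hq andbT. Qed.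

(** Transitivity on 3-arcs, by enumeration. The model arc is chosen so that its two end edges are
    the negative edges of [negP22], and so that it runs along the hexagon of [negP32]. *)
Lemma three_arc (u0 u1 u2 u3 : vertex) :
  adj u0 u1 -> adj u1 u2 -> adj u2 u3 -> u0 != u2 -> u1 != u3 ->
  exists t, [/\ u0 = vlab t (o0, o3), u1 = vlab t (o1, o4), u2 = vlab t (o2, o3) &
                u3 = vlab t (o0, o4)].
Proof.
have [[p0 h0 ->] [p1 h1 ->]] := (vlab_surj 1 u0, vlab_surj 1 u1).
have [[p2 h2 ->] [p3 h3 ->]] := (vlab_surj 1 u2, vlab_surj 1 u3).
have [[q0 q1] [q2 q3]] := (vpair_pairs h0, vpair_pairs h1,
  (vpair_pairs h2, vpair_pairs h3)).
rewrite !adj_vlab // !eq_vlab // => a01 a12 a23 n02 n13.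
have : all (fun p0 => all (fun p1 => all (fun p2 => all (fun p3 =>
    has (fun x => [&& eqp p0 (mapp x (o0, o3)), eqp p1 (mapp x (o1, o4)),
           eqp p2 (mapp x (o2, o3)) & eqp p3 (mapp x (o0, o4))]) codes)
    [seq q <- nbrs p2 | ~~ eqp p1 q]) [seq q <- nbrs p1 | ~~ eqp p0 q])
    (nbrs p0)) pairs by vm_cast_no_check (erefl true).
move/allP/(_ _ h0)/allP/(_ p1); rewrite mem_nbrs // => /(_ a01)/allP/(_ p2).
rewrite mem_filter mem_nbrs // n02 => /(_ a12)/allP/(_ p3).
rewrite mem_filter mem_nbrs // n13 => /(_ a23)/has_codes[t].
by case/and4P=> *; exists t; split; apply: eqp_vlab.
Qed.

Definition fix_step (F : seq ('I_5 * 'I_5)) :=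
  [seq v <- pairs | (v \in F) || all (fun w =>
     (w == v) || has (fun x => disj v x != disj w x) F) pairs].

(* A vertex that is determined by its adjacencies to fixed vertices is fixed. *)
Lemma fix_stepP (b : {perm vertex}) F : b \in AutP ->
  {subset F <= pairs} -> {in F, forall p, b (vlab 1 p) = vlab 1 p} ->
  {in fix_step F, forall p, b (vlab 1 p) = vlab 1 p}.
Proof.
move=> /AutPP hb FP fixF v; rewrite mem_filter => /andP[/orP[/fixF//|/allP h vP]].
have [w wP bv] := vlab_surj 1 (b (vlab 1 v)); rewrite bv.
have /orP[/eqP->//|/hasP[x xF]] := h w wP.
have := hb (vlab 1 v) (vlab 1 x); rewrite bv fixF //
  !adj_vlab ?(vpair_pairs (FP _ xF)) ?vpair_pairs //.
by move=> ->; rewrite eqxx.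
Qed.

Lemma AutP_fix (b : {perm vertex}) : b \in AutP ->
  {in [:: (o0, o3); (o1, o4); (o2, o3); (o0, o4)],
    forall p, b (vlab 1 p) = vlab 1 p} ->
  b = 1.
Proof.
move=> hb /(fix_stepP hb)-/(_ _)h.
have sub F : {subset fix_step F <= pairs} by move=> x; rewrite mem_filter => /andP[].
have /(fix_stepP hb (sub _))/(fix_stepP hb (sub _)) :=
  h (allP (erefl : all (mem pairs) [:: (o0, o3); (o1, o4); (o2, o3); (o0, o4)])).
(* Three rounds starting from the arc reach all ten vertices. *)
have -> : fix_step (fix_step (fix_step
    [:: (o0, o3); (o1, o4); (o2, o3); (o0, o4)])) = pairs by vm_compute.
move=> fixb; apply/permP=> v; rewrite perm1.
by have [p /fixb + ->] := vlab_surj 1 v.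
Qed.

(** If t takes the model arc to its image under a, then a followed by the inverse of [pact t] fixes
    the arc, hence is the identity. *)
Lemma AutP_pact : AutP = pact @: [set: 'S_5].
Proof.
apply/setP=> a; apply/idP/imsetP=> [ha|[s _ ->]]; last exact: pact_AutP.
have /AutPP ha' := ha.
have [||||| t [e0 e1 e2 e3]] := @three_arc (a (vlab 1 (o0, o3))) (a (vlab 1 (o1, o4)))
  (a (vlab 1 (o2, o3))) (a (vlab 1 (o0, o4))).
1-5: by rewrite ?ha' ?adj_vlab ?(inj_eq perm_inj) ?eq_vlab.
exists t => //; apply/eqP; rewrite eq_mulgV1; apply/eqP.
apply: AutP_fix => [|p]; first by rewrite groupM ?groupV ?pact_AutP.
have E q : vpair q -> (pact t)^-1 (vlab t q) = vlab 1 q.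
  move=> hq; apply: (canLR (permK _)); rewrite (pact_vlab t 1) // invg1 conjg1.
  exact: vlab_code.
by rewrite !inE permM => /or4P[] /eqP->; rewrite (e0, e1, e2, e3) E.
Qed.

(** * Switching automorphisms *)

Lemma disj_mapp s p q : disj (mapp (code s) p) (mapp (code s) q) = disj p q.
Proof. by rewrite /disj /= !capp_code !(inj_eq perm_inj). Qed.

(** P is connected: two distinct vertices are adjacent or have a common neighbour. *)
Lemma adj_const (T : Type) (f : vertex -> T) :
  (forall u w, adj u w -> f u = f w) -> forall u w, f u = f w.
Proof.
move=> hf u w; have [[p hp ->] [q hq ->]] := (vlab_surj 1 u, vlab_surj 1 w).
have : all (fun p => all (fun q => [|| p == q, disj p q |
    has (fun r => disj p r && disj r q) pairs]) pairs) pairs by vm_compute.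
move/allP/(_ _ hp)/allP/(_ _ hq).
case/or3P=> [/eqP-> //|pq|/hasP[r hr /andP[pr rq]]].
  by apply: hf; rewrite adj_vlab ?vpair_pairs.
by transitivity (f (vlab 1 r)); apply: hf; rewrite adj_vlab ?vpair_pairs.
Qed.

(** The equation $(\sigma^\zeta)^\alpha=\sigma$ read at the image of a single edge, in labels. *)
Lemma swstab_pact sg t (z : switching) s p q :
  SwPerm z (pact s) \in swstab sg -> vpair p -> vpair q -> disj p q ->
  let x := mapp (code (s ^ t^-1)) in
  sig_at sg [set vlab t (x p); vlab t (x q)] =
  z (vlab t p) (+) sig_at sg [set vlab t p; vlab t q] (+) z (vlab t q).
Proof.
rewrite in_set mem_swAutP pact_AutP /= => /eqP e hp hq pq.
have pqV : adj (vlab t p) (vlab t q) by rewrite adj_vlab.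
by rewrite -!pact_vlab // -[in LHS]e sig_actE ?pact_AutP // switchE.
Qed.

Lemma pact_swstab sg t (z : switching) s :
  (forall p q, p \in pairs -> q \in pairs -> disj p q ->
     let x := mapp (code (s ^ t^-1)) in
     sig_at sg [set vlab t (x p); vlab t (x q)] =
     z (vlab t p) (+) sig_at sg [set vlab t p; vlab t q] (+) z (vlab t q)) ->
  SwPerm z (pact s) \in swstab sg.
Proof.
move=> h; rewrite in_set mem_swAutP pact_AutP /=; apply/eqP.
apply: sig_eqP => u w uw; rewrite -(permKV (pact s) u) -(permKV (pact s) w).
move: uw; rewrite -{1}(permKV (pact s) u) -{1}(permKV (pact s) w).
have /AutPP-> := pact_AutP s.
case: (vlab_surj t ((pact s)^-1 u)) (vlab_surj t ((pact s)^-1 w)).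
move=> p hp -> [q hq ->] pq.
rewrite sig_actE ?pact_AutP // switchE // !pact_vlab ?vpair_pairs //.
by rewrite h // -(adj_vlab t) ?vpair_pairs.
Qed.

Lemma Aut_swstab sg a : (a \in Aut_sig sg) = (SwPerm eps a \in swstab sg).
Proof. by rewrite [LHS]in_set [RHS]in_set mem_swAutP /= switch_eps. Qed.

Lemma bar_SwAut sg z a : SwPerm z a \in swstab sg -> bar z a \in SwAut_sig sg.
Proof. by move=> h; apply/imsetP; exists (SwPerm z a). Qed.

Lemma SwAutP sg x : x \in SwAut_sig sg ->
  exists z s, x = bar z (pact s) /\ SwPerm z (pact s) \in swstab sg.
Proof.
case/imsetP=> -[z a] h ->; have: a \in AutP.
  by case/setIdP: h => [+ _]; rewrite mem_swAutP.
by rewrite AutP_pact => /imsetP[s _ ea]; exists z, s; rewrite -ea.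
Qed.

Lemma sig_at_sigN sg u w : adj u w ->
  sig_at (sigN sg) [set u; w] = ~~ sig_at sg [set u; w].
Proof.
move=> uw; pose e := Edge (adj_is_edge uw).
by rewrite !(sig_atE _ e : sig_at _ [set u; w] = _) ffunE.
Qed.

(** Negation changes the sign of an edge and of its image together, so the edge equation is
    unaffected. This reduces every claim to the signature before negation. *)
Lemma swstab_sigN sg : swstab (sigN sg) = swstab sg.
Proof.
apply/setP=> -[z a]; have [|aN] := boolP (a \in AutP); last first.
  by apply/idP/idP => /setIdP[]; rewrite mem_swAutP /= (negPf aN).
rewrite AutP_pact => /imsetP[s _ ->].
by apply/idP/idP => h; apply: (@pact_swstab _ 1) => p q
  /vpair_pairs hp /vpair_pairs hq pq x; have := swstab_pact 1 h hp hq pq;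
  rewrite /= -/x !sig_at_sigN ?adj_vlab ?disj_mapp ?vpair_mapp //;
  case: (z _); case: (z _); do 2!case: sig_at.
Qed.

Lemma Aut_sigN sg : Aut_sig (sigN sg) = Aut_sig sg.
Proof. by apply/setP=> a; rewrite !Aut_swstab swstab_sigN. Qed.

Lemma SwAut_sigN sg : SwAut_sig (sigN sg) = SwAut_sig sg.
Proof. by rewrite /SwAut_sig swstab_sigN. Qed.

Lemma bar_repr (x : coset_of pmeps) : x = bar (sw_of (repr x)) (pA x).
Proof. by rewrite -{1}[x]coset_reprK /bar /pA; case: (repr x). Qed.

Lemma mem_pmeps_norm x : x \in 'N(pmeps).
Proof. by rewrite (subsetP pmeps_norm) ?inE. Qed.

Lemma barM z a y b :
  bar z a * bar y b = bar (sw_mul z (sw_act y a^-1)) (a * b).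
Proof.
rewrite -[RHS]/(coset _ (SwPerm z a * SwPerm y b)).
by rewrite morphM ?mem_pmeps_norm.
Qed.

Lemma pAM : {morph pA : x y / x * y}.
Proof. by move=> x y; rewrite {1}(bar_repr x) {1}(bar_repr y) barM pA_bar. Qed.
Canonical pA_morphism := @Morphism _ _ setT pA (in2W pAM).

(** Comparing the edge equations of two switching functions with the same automorphism shows that
    their product agrees at adjacent vertices. It is therefore $\pm\varepsilon$, which the quotient
    kills. *)
Lemma pA_inj sg : {in SwAut_sig sg &, injective pA}.
Proof.
move=> x y /SwAutP[z [s [-> hz]]] /SwAutP[z' [s' [-> hz']]].
rewrite !pA_bar => /pact_inj es; rewrite -{}es in hz' *.
have dE : forall u w, z u (+) z' u = z w (+) z' w.
  apply: adj_const => u w.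
  have [p /vpair_pairs hp ->] := vlab_surj 1 u.
  have [q /vpair_pairs hq ->] := vlab_surj 1 w.
  rewrite adj_vlab // => pq; have /= := swstab_pact 1 hz hp hq pq.
  have /= -> := swstab_pact 1 hz' hp hq pq.
  by case: (z _); case: (z _); case: (z' _); case: (z' _); case: sig_at.
have [e|e] := eqVneq z z'; first by rewrite e.
suff E : SwPerm z (pact s) = SwPerm negeps 1 * SwPerm z' (pact s).
  by rewrite /bar E coset_kerl ?set22.
rewrite swpermM mul1g; congr SwPerm; apply/ffunP=> u.
rewrite !ffunE inE invg1 invg1 perm1.
have [v] : exists v, z v != z' v.
  apply/existsP; apply: contraR e; rewrite negb_exists => /forallP h.
  by apply/eqP/ffunP=> v; apply/eqP; have := h v; rewrite negbK.
by have := dE u v; case: (z _); case: (z _); case: (z' _); case: (z' _).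
Qed.

(** * Signatures as edge lists, and the 5-cycle test *)

Definition eqe (e f : ('I_5 * 'I_5) * ('I_5 * 'I_5)) :=
  (eqp e.1 f.1 && eqp e.2 f.2) || (eqp e.1 f.2 && eqp e.2 f.1).

(* The sign of the edge pq in the signature with negative edge set L. *)
Definition esign (L : seq (('I_5 * 'I_5) * ('I_5 * 'I_5))) p q :=
  has (eqe (p, q)) L.

Definition coded sg t L := forall p q, vpair p -> vpair q -> disj p q ->
  sig_at sg [set vlab t p; vlab t q] = esign L p q.

(* x is the code of an alpha with (sigma^z)^alpha = sigma, for the signature
   sigma with negative edge set L. *)
Definition sw_ok (z : pred ('I_5 * 'I_5)) L x :=
  all (fun p => all (fun q =>
    esign L (mapp x p) (mapp x q) == z p (+) esign L p q (+) z q) (nbrs p)) pairs.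

Lemma coded_swstab sg t L (z : switching) (zc : pred ('I_5 * 'I_5)) s :
  coded sg t L -> {in pairs, forall p, z (vlab t p) = zc p} ->
  sw_ok zc L (code (s ^ t^-1)) -> SwPerm z (pact s) \in swstab sg.
Proof.
move=> cd zE /allP ok; apply: (@pact_swstab _ t) => p q hp hq pq /=.
rewrite !cd ?vpair_mapp ?disj_mapp ?vpair_pairs // !zE //.
by have /allP/(_ q) := ok p hp; rewrite mem_nbrs // pq => /(_ isT)/eqP.
Qed.

(** The predicate [xpred0] is the trivial switching, so these permutations preserve the negative
    edges when the letters are [o0], ..., [o4]. *)
Definition Aut_neg L := [set s : 'S_5 | sw_ok xpred0 L (code s)].

Lemma Aut_sigE sg t L : coded sg t L -> Aut_sig sg = pact @: (Aut_neg L :^ t).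
Proof.
move=> cd; apply/setP=> a; rewrite Aut_swstab; apply/idP/imsetP=> [h|[s hs ->]].
  have : a \in AutP by case/setIdP: h => [+ _]; rewrite mem_swAutP.
  rewrite AutP_pact => /imsetP[s _ ea]; exists s => //.
  rewrite mem_conjg inE; apply/allP=> p hp; apply/allP=> q.
  rewrite mem_filter => /andP[pq hq]; rewrite ea in h.
  have := swstab_pact t h (vpair_pairs hp) (vpair_pairs hq) pq.
  rewrite /= !cd ?vpair_mapp ?disj_mapp ?vpair_pairs // => ->.
  by rewrite !ffunE !inE.
move: hs; rewrite mem_conjg inE; apply: coded_swstab => // p _.
by rewrite ffunE inE.
Qed.

(* The sum around the 5-cycle v_ab v_cd v_ea v_bc v_de, for [a; b; c; d; e] = x. *)
Definition pent_sum L x :=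
  let f a b c d := esign L (mapp x (a, b)) (mapp x (c, d)) in
  f o0 o1 o2 o3 (+) f o2 o3 o4 o0 (+) f o4 o0 o1 o2 (+) f o1 o2 o3 o4 (+)
  f o3 o4 o0 o1.

(* One list for each of the twelve 5-cycles, up to rotation and reflection. *)
Definition pentagons : seq (seq 'I_5) :=
  [seq y <- codes | (capp y o0 == o0) && (capp y o1 < capp y o4)%N].

Definition pent_ok L x :=
  all (fun y => pent_sum L (ccomp y x) == pent_sum L y) pentagons.

Lemma mapp_codeM s r p : mapp (code (s * r)) p = mapp (code r) (mapp (code s) p).
Proof. by rewrite /mapp !capp_code !permM. Qed.

(** Around a 5-cycle each switching value occurs twice, once for each incident edge, and cancels.
    The projection must therefore preserve the sign of every 5-cycle. *)
Lemma SwAut_pent sg t L x : coded sg t L -> x \in SwAut_sig sg ->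
  exists2 s, pA x = pact s & pent_ok L (code (s ^ t^-1)).
Proof.
move=> cd /SwAutP[z [s [-> hz]]]; exists s; first exact: pA_bar.
have := swstab_pact t hz; move: (s ^ t^-1) => s' hs'.
apply/allP=> y; rewrite mem_filter => /andP[_ /codeP[r <-]].
rewrite -codeM /pent_sum !mapp_codeM.
have E a b c d : uniq [:: a; b; c; d] ->
    let m := mapp (code r) in
    esign L (mapp (code s') (m (a, b))) (mapp (code s') (m (c, d))) =
    z (vlab t (m (a, b))) (+) esign L (m (a, b)) (m (c, d)) (+) z (vlab t (m (c, d))).
  rewrite /= !inE !negb_or.
  case/andP=> /and3P[ab ac ad] /andP[/andP[bc bd] /andP[cd' _]].
  set p := mapp (code r) (a, b); set q := mapp (code r) (c, d).
  have hp : vpair p by apply: vpair_mapp.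
  have hq : vpair q by apply: vpair_mapp.
  have pq : disj p q by rewrite disj_mapp /disj /= ac ad bc bd.
  have := hs' p q hp hq pq; rewrite /= !cd //; first exact: vpair_mapp.
    exact: vpair_mapp.
  by rewrite disj_mapp.
rewrite !E //.
by do 5!case: (z _); do 5!case: (esign _ _ _).
Qed.

(** If only sign-preserving permutations pass the 5-cycle test, every switching automorphism has the
    projection of some [bar eps a] in the group, and injectivity of [pA] identifies the two. *)
Lemma SwAut_eps_bar sg t L : coded sg t L ->
  all (fun x => pent_ok L x ==> sw_ok xpred0 L x) codes ->
  SwAut_sig sg = eps_bar (Aut_sig sg).
Proof.
move=> cd /all_codes h; apply/setP=> x; apply/idP/imsetP=> [hx|[a + ->]]; last first.
  by rewrite Aut_swstab => /bar_SwAut.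
have [s e /(implyP (h _)) ok] := SwAut_pent cd hx.
have hs : pact s \in Aut_sig sg.
  by rewrite (Aut_sigE cd) imset_f // mem_conjg inE.
exists (pact s) => //; apply: (pA_inj hx); last by rewrite pA_bar.
by apply: bar_SwAut; rewrite -Aut_swstab.
Qed.

Lemma pmsigE tau sg : pmsig tau sg ->
  Aut_sig sg = Aut_sig tau /\ SwAut_sig sg = SwAut_sig tau.
Proof. by case=> ->; rewrite ?Aut_sigN ?SwAut_sigN. Qed.

Lemma sig_at_sigP S u w : adj u w -> sig_at (sigP S) [set u; w] = ([set u; w] \in S).
Proof.
move=> uw; pose e := Edge (adj_is_edge uw).
by rewrite (sig_atE _ e : sig_at _ [set u; w] = _) ffunE.
Qed.

Lemma edge_eqe t p q a b c d : vpair p -> vpair q -> a != b -> c != d ->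
  ([set vlab t p; vlab t q] == [set vtx (t a) (t b); vtx (t c) (t d)]) =
  eqe (p, q) ((a, b), (c, d)).
Proof.
move=> hp hq ab cd; rewrite -/(vlab t (a, b)) -/(vlab t (c, d)) eq_set2.
by rewrite !eq_vlab.
Qed.

Lemma tperm_conj (t : 'S_5) a b : tperm (t a) (t b) = tperm a b ^ t.
Proof. by rewrite tpermJ. Qed.

Lemma cyc4_conj (t : 'S_5) a b c d :
  cyc4 (t a) (t b) (t c) (t d) = cyc4 a b c d ^ t.
Proof. by rewrite /cyc4 !conjMg !tpermJ. Qed.

(** * Identifying groups from generators *)

Definition gen_check (Q : pred (seq 'I_5)) n cgs :=
  let W := filter Q codes in let ws := words n cgs in
  [&& all (mem ws) W, all (mem W) (o5 :: cgs) &
      all (fun x => all (fun y => ccomp x y \in W) W) W].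

(** The words give one inclusion. For the other, the set selected by Q contains 1 and is closed
    under products, hence is a group, and it contains the generators. *)
Lemma gen_codes Q n (gs : seq 'S_5) cgs (A : {set 'S_5}) :
  A =i gs -> map code gs = cgs -> gen_check Q n cgs ->
  [set s | Q (code s)] = <<A>>.
Proof.
pose W := filter Q codes.
move=> Ags <- /and3P[/allP hw /andP[h1 /allP hg] /allP hW].
have WE s : (code s \in W) = (s \in [set s | Q (code s)]).
  by rewrite mem_filter code_codes andbT inE.
apply/eqP; rewrite eqEsubset; apply/andP; split.
  apply/subsetP=> s; rewrite -WE => /hw; apply: words_gen => g.
  by rewrite Ags.
have gS : group_set [set s | Q (code s)].
  apply/group_setP; split=> [|s r]; first by rewrite -WE code1.
  by rewrite -!WE codeM => /hW/allP; apply.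
suff: A \subset Group gS by rewrite -gen_subG.
apply/subsetP=> g.
by rewrite Ags -WE => gA; apply/hg/map_f.
Qed.

Lemma conj_codes (Q : pred (seq 'I_5)) (t s : 'S_5) :
  (s \in [set s | Q (code s)] :^ t) = Q (code (s ^ t^-1)).
Proof. by rewrite mem_conjg inE. Qed.

Lemma SwAut_isog sg : SwAut_sig sg \isog pA @: SwAut_sig sg.
Proof.
pose f := @Morphism _ _ (SwAut_sig sg) pA (in2W pAM).
have inj : 'injm f by apply/injmP; apply: pA_inj.
by have := sub_isog (subxx _) inj; rewrite morphimEdom.
Qed.

Lemma pact_isog (H : {group 'S_5}) (t : 'S_5) : H \isog pact @: (H :^ t).
Proof.
have e : pact_morphism @* (H :^ t) = pact @: (H :^ t).
  by rewrite morphimEsub ?subsetT.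
rewrite -e; apply: (@isog_trans _ _ _ _ (H :^ t)%G _ (conj_isog H t)).
exact: (sub_isog (subsetT _) injm_pact).
Qed.

Lemma pA_eps_bar G : pA @: eps_bar G = G.
Proof.
rewrite /eps_bar -imset_comp -[RHS]imset_id; apply: eq_imset => a /=.
exact: pA_bar.
Qed.

(** Because [pA] is injective on the whole group, a subgroup with at least as large a projection is
    everything. *)
Lemma SwAut_gen sg (A : {set coset_of pmeps}) (B : {set 'S_5}) :
  A \subset SwAut_sig sg -> pA @: A = pact @: B ->
  {in SwAut_sig sg, forall x, pA x \in pact @: <<B>>} -> SwAut_sig sg = <<A>>.
Proof.
move=> sA eA h; have sgA : <<A>> \subset SwAut_sig sg by rewrite gen_subG.
apply/eqP; rewrite eqEsubset sgA andbT; apply/subsetP=> x hx.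
have : pA x \in pA @* <<A>>.
  rewrite morphim_gen ?subsetT // morphimEsub ?subsetT // eA.
  by have := h x hx; rewrite -morphimEsub ?subsetT // morphim_gen ?subsetT //
    morphimEsub ?subsetT.
case/morphimP=> y _ hy /(pA_inj hx) -> //.
exact: (subsetP sgA).
Qed.

(** * The groups for the five negative edge sets *)

Definition negP1 := [:: ((o0, o1), (o2, o3))].
Definition negP22 := [:: ((o0, o3), (o1, o4)); ((o2, o3), (o0, o4))].
Definition negP23 := [:: ((o0, o2), (o1, o3)); ((o0, o3), (o1, o2))].
Definition negP32 :=
  [:: ((o0, o3), (o1, o4)); ((o2, o3), (o0, o4)); ((o1, o3), (o2, o4))].
Definition negP33 :=
  [:: ((o0, o1), (o2, o3)); ((o0, o2), (o1, o3)); ((o0, o3), (o1, o2))].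

Ltac gens := by move=> ?; rewrite !inE.
Ltac code_gens := by rewrite /= ?code_cyc4 ?codeM ?code_tperm.

Definition perm_D8 : {set 'S_5} := <<[set tperm o0 o1; cyc4 o0 o2 o1 o3]>>.

Lemma Aut_negP1 : Aut_neg negP1 = perm_D8.
Proof.
(* Words of length at most 5 already give the whole group, as the final evaluation confirms. *)
apply: (@gen_codes _ 5 [:: _; _]
  [:: ctperm o0 o1; ccyc4 o0 o2 o1 o3]).
- gens.
- code_gens.
by vm_compute.
Qed.

Lemma Aut_negP23 : Aut_neg negP23 = perm_D8.
Proof.
apply: (@gen_codes _ 5 [:: _; _]
  [:: ctperm o0 o1; ccyc4 o0 o2 o1 o3]).
- gens.
- code_gens.
by vm_compute.
Qed.

Lemma Aut_negP22 : Aut_neg negP22 = <<[set tperm o1 o2 * tperm o3 o4]>>.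
Proof.
apply: (@gen_codes _ 5 [:: _]
  [:: ccomp (ctperm o1 o2) (ctperm o3 o4)]).
- gens.
- code_gens.
by vm_compute.
Qed.

Definition perm_V4 : {set 'S_5} :=
  <<[set tperm o1 o2 * tperm o3 o4; tperm o1 o3 * tperm o2 o4]>>.

(** An upper bound for the projection of the switching automorphism group; [AutE_P22] shows that it
    is attained. *)
Lemma pent_negP22 : [set s | pent_ok negP22 (code s)] = perm_V4.
Proof.
apply: (@gen_codes _ 5 [:: _; _]
  [:: ccomp (ctperm o1 o2) (ctperm o3 o4); ccomp (ctperm o1 o3) (ctperm o2 o4)]).
- gens.
- code_gens.
by vm_compute.
Qed.

Definition perm_S3 : {set 'S_5} :=
  <<[set tperm o0 o1 * tperm o3 o4; tperm o1 o2 * tperm o3 o4]>>.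

Lemma Aut_negP32 : Aut_neg negP32 = perm_S3.
Proof.
apply: (@gen_codes _ 5 [:: _; _]
  [:: ccomp (ctperm o0 o1) (ctperm o3 o4); ccomp (ctperm o1 o2) (ctperm o3 o4)]).
- gens.
- code_gens.
by vm_compute.
Qed.

(** Parity is recorded so that an odd permutation can be excluded from the words in even
    generators. *)
Lemma even_words n (gs : seq 'S_5) cgs (s : 'S_5) :
  map code gs = cgs -> all (fun g => g \in 'Alt_('I_5)) gs ->
  code s \in words n cgs -> s \in <<[set g in gs]>> /\ s \in 'Alt_('I_5).
Proof.
move=> <- /allP ev hs.
have hg : s \in <<[set g in gs]>>.
  by apply: words_gen hs => g; rewrite inE.
split=> //; apply: (subsetP _ s hg); rewrite gen_subG.
by apply/subsetP=> g; rewrite inE => /ev.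
Qed.

(** The first two generate [perm_S3]; the third is the projection of the switching automorphism
    [swap_jl_km] in the standard labelling. *)
Definition A5gens : seq 'S_5 :=
  [:: tperm o0 o1 * tperm o3 o4; tperm o1 o2 * tperm o3 o4;
      tperm o1 o3 * tperm o2 o4].

Definition cA5gens := [:: ccomp (ctperm o0 o1) (ctperm o3 o4);
  ccomp (ctperm o1 o2) (ctperm o3 o4); ccomp (ctperm o1 o3) (ctperm o2 o4)].

Definition A5words := words 8 cA5gens.

Lemma map_A5gens : map code A5gens = cA5gens.
Proof. code_gens. Qed.

Lemma A5gens_even : all (fun g => g \in 'Alt_('I_5)) A5gens.
Proof. by rewrite /= !Alt_even !odd_permM !odd_tperm. Qed.

Lemma Alt_gens : 'Alt_('I_5) = <<[set g in A5gens]>>.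
Proof.
apply/eqP; rewrite eqEsubset; apply/andP; split; last first.
  rewrite gen_subG; apply/subsetP=> g; rewrite inE.
  by move/(allP A5gens_even).
apply/subsetP=> s; rewrite Alt_even => es.
(* Either s or s (01) is a word in the generators, and the latter is odd. *)
have := @all_codes (fun x =>
   (x \in A5words) || (ccomp x (ctperm o0 o1) \in A5words)).
case/(_ _ s)/orP=> [|/(even_words map_A5gens A5gens_even)[]//|]; first by vm_compute.
rewrite -code_tperm -codeM => /(even_words map_A5gens A5gens_even)[_].
by rewrite Alt_even odd_permM odd_tperm addbT es.
Qed.

Lemma pent_negP32 s : pent_ok negP32 (code s) -> s \in 'Alt_('I_5).
Proof.
have /all_codes/(_ s)/implyP h :
  all (fun x => pent_ok negP32 x ==> (x \in A5words)) codes.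
  by vm_compute.
by move/h/(even_words map_A5gens A5gens_even)=> [].
Qed.

(** The three edges are the three ways to split the first four letters into two pairs, so preserving
    them amounts to fixing the last letter. *)
Lemma Aut_negP33 : Aut_neg negP33 = [set s : 'S_5 | s o4 == o4].
Proof.
apply/setP=> s; rewrite !inE -[s o4 == _](congr1 (fun a => a == o4) (capp_code s o4)).
apply/eqP; apply: (@all_codes (fun x => sw_ok xpred0 negP33 x == (capp x o4 == o4))).
by vm_compute.
Qed.

Lemma Aut_neg_nil : Aut_neg [::] = setT.
Proof.
apply/setP=> s; rewrite !inE; apply: (@all_codes (sw_ok xpred0 [::])).
by vm_compute.
Qed.

(** * Isomorphism types of the permutation groups *)

Lemma code_order2 s c : code s = c -> ccomp c c = o5 -> c != o5 -> #[s] = 2.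
Proof.
move=> <- e n1; apply: nt_prime_order => //.
  by apply: code_inj; rewrite code1 -e -codeM.
by apply: contraNneq n1 => ->; rewrite code1.
Qed.

Lemma isog_dihedral (x y : 'S_5) cx cy n (A : {set 'S_5}) :
  code x = cx -> code y = cy -> ccomp cx cx = o5 -> ccomp cy cy = o5 ->
  cx != o5 -> cy != o5 -> cx != cy -> A = <<[set x; y]>> -> #|A| = n ->
  A \isog 'D_n.
Proof.
move=> ex ey xx yy nx ny nxy -> <-.
apply: involutions_gen_dihedral; first exact: code_order2 ex _ _.
  exact: code_order2 ey _ _.
by apply: contraNneq nxy => e; rewrite -ex -ey e.
Qed.

Lemma D8_isog : perm_D8 \isog 'D_8.
Proof.
(* A dihedral group is recognized from two involutions, so the 4-cycle is replaced by (02)(13),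
   which with (01) generates the same group. *)
apply: (@isog_dihedral (tperm o0 o1) (tperm o0 o2 * tperm o1 o3)
  (ctperm o0 o1) (ccomp (ctperm o0 o2) (ctperm o1 o3))) => //; try code_gens.
  rewrite -Aut_negP1; apply: (@gen_codes _ 5 [:: _; _]
    [:: ctperm o0 o1; ccomp (ctperm o0 o2) (ctperm o1 o3)]).
  - gens.
  - code_gens.
  by vm_compute.
by rewrite -Aut_negP1 card_code; vm_compute.
Qed.

(** Both groups have order 6 and are generated by two distinct involutions, so both are dihedral. *)
Lemma S3_isog : perm_S3 \isog [set: 'S_3].
Proof.
have S3D : perm_S3 \isog 'D_6.
  apply: (@isog_dihedral (tperm o0 o1 * tperm o3 o4) (tperm o1 o2 * tperm o3 o4)
  (ccomp (ctperm o0 o1) (ctperm o3 o4)) (ccomp (ctperm o1 o2) (ctperm o3 o4)))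
    => //; try code_gens.
  by rewrite -Aut_negP32 card_code; vm_compute.
have o6 : #|[set: 'S_3]| = 6 by rewrite cardsT card_Sn.
pose a0 : 'I_3 := ord0; pose a1 : 'I_3 := inord 1; pose a2 : 'I_3 := inord 2.
have n01 : a0 != a1 by rewrite -val_eqE /= inordK.
have n02 : a0 != a2 by rewrite -val_eqE /= inordK.
have n12 : a1 != a2 by rewrite -val_eqE /= !inordK.
have gT : <<[set tperm a0 a1; tperm a0 a2]>> = [set: 'S_3].
  apply/eqP; rewrite eqEsubset subsetT -(gen_tperm a0) gen_subG.
  apply/subsetP=> s /imsetP[y _ ->].
  have : [|| y == a0, y == a1 | y == a2].
    by rewrite -!val_eqE /= !inordK //; case: y => [[|[|[|]]]].
  case/or3P=> /eqP->; first by rewrite tperm1 group1.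
    by rewrite mem_gen ?set21.
  by rewrite mem_gen ?set22.
have t2 (a b : 'I_3) : a != b -> #[tperm a b] = 2.
  move=> ab; apply: nt_prime_order => //; first exact: tperm2.
  by apply: contraNneq ab => e; rewrite -[b](tpermL a) e perm1.
have D : [set: 'S_3] \isog 'D_6.
  rewrite -o6 -gT; apply: involutions_gen_dihedral; rewrite ?t2 //.
  apply: contraNneq n12 => e; rewrite -(tpermL a0 a1) e; apply/eqP.
  exact: tpermL.
apply: (@isog_trans _ _ _ _ [set: 'D_6]%G _ S3D).
by rewrite isog_sym.
Qed.

(** Elementary abelian 2-groups of the same order, here 4, are isomorphic. *)
Lemma V4_isog : perm_V4 \isog setX (Zp 2) (Zp 2).
Proof.
have ab : 2.-abelem perm_V4.
  apply: exponent2_abelem; apply/exponentP=> s sV.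
  have := sV : s \in perm_V4; rewrite -pent_negP22 inE => hs.
  apply: code_inj; rewrite codeM code1.
  have /all_codes/(_ s)/implyP h :
    all (fun x => pent_ok negP22 x ==> (ccomp x x == o5)) codes by vm_compute.
  exact/eqP/h.
have card4 : #|perm_V4| = 4 by rewrite -pent_negP22 card_code; vm_compute.
rewrite (isog_abelem_card _ ab) /= card4 cardsX card_Zp // andbT.
apply: exponent2_abelem; apply/exponentP=> -[x y] _.
by apply/eqP; case: x y => [[|[|]]// ?] [[|[|]]// ?].
Qed.

Lemma Z2_isog : <<[set tperm o1 o2 * tperm o3 o4]>> \isog Zp 2.
Proof.
rewrite isog_cyclic_card ?cycle_cyclic // card_Zp // -[#|<<_>>|]/(#[_]).
rewrite (@code_order2 _ (ccomp (ctperm o1 o2) (ctperm o3 o4))) //; last code_gens.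
by rewrite eqxx andbT; apply: prime_cyclic; rewrite card_Zp.
Qed.

(** Extending a permutation of four letters by a fixed last letter is injective into the stabilizer,
    and both sides have order 24. *)
Lemma S4_isog (A : {set 'S_5}) : A = [set s : 'S_5 | s o4 == o4] ->
  A \isog [set: 'S_4].
Proof.
move=> ->.
pose f := @Morphism _ _ [set: 'S_4] (@lift_perm 4 o4 o4)
  (in2W (fun s t => esym (lift_permM o4 o4 o4 s t))).
have inj : 'injm f.
  apply/injmP=> s r _ _ e; apply/permP=> x; apply: (@lift_inj _ o4).
  by rewrite -!(lift_perm_lift o4 o4) -[lift_perm _ _ s]/(f s) e.
have fE : f @* [set: 'S_4] = [set s : 'S_5 | s o4 == o4].
  apply/eqP; rewrite eqEcard; apply/andP; split.
    by apply/subsetP=> _ /morphimP[s _ _ ->]; rewrite inE /= lift_perm_id.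
  rewrite card_injm ?subxx // cardsT card_Sn.
  by rewrite (card_code (fun x => capp x o4 == o4)).
by rewrite -fE isog_sym; apply: (sub_isog (subxx _)).
Qed.

(** * The automorphism groups of the labelled signatures *)

Ltac coded_tac :=
  by move=> p q hp hq pq; rewrite sig_at_sigP ?adj_vlab // !inE ?edge_eqe //
    /esign /= ?orbF ?orbA.

Lemma coded_plusP t : coded plusP t [::].
Proof. coded_tac. Qed.

(* The signatures of parts (2), (3), (4), (5) and (6). *)
Definition sigP1 (t : 'S_5) :=
  sigP [set [set vtx (t o0) (t o1); vtx (t o2) (t o3)]].
Definition sigP22 (t : 'S_5) :=
  sigP [set [set vtx (t o0) (t o3); vtx (t o1) (t o4)];
            [set vtx (t o2) (t o3); vtx (t o0) (t o4)]].
Definition sigP23 (t : 'S_5) :=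
  sigP [set [set vtx (t o0) (t o2); vtx (t o1) (t o3)];
            [set vtx (t o0) (t o3); vtx (t o1) (t o2)]].
Definition sigP32 (t : 'S_5) :=
  sigP [set [set vtx (t o0) (t o3); vtx (t o1) (t o4)];
            [set vtx (t o2) (t o3); vtx (t o0) (t o4)];
            [set vtx (t o1) (t o3); vtx (t o2) (t o4)]].
Definition sigP33 (t : 'S_5) :=
  sigP [set [set vtx (t o0) (t o1); vtx (t o2) (t o3)];
            [set vtx (t o0) (t o2); vtx (t o1) (t o3)];
            [set vtx (t o0) (t o3); vtx (t o1) (t o2)]].

Lemma coded_P1 t : coded (sigP1 t) t negP1.
Proof. coded_tac. Qed.
Lemma coded_P22 t : coded (sigP22 t) t negP22.
Proof. coded_tac. Qed.
Lemma coded_P23 t : coded (sigP23 t) t negP23.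
Proof. coded_tac. Qed.
Lemma coded_P32 t : coded (sigP32 t) t negP32.
Proof. coded_tac. Qed.
Lemma coded_P33 t : coded (sigP33 t) t negP33.
Proof. coded_tac. Qed.

Lemma AutE_plusP :
  Aut_sig plusP = pact @: [set: 'S_5] /\
  SwAut_sig plusP = eps_bar (pact @: [set: 'S_5]).
Proof.
have A : Aut_sig plusP = pact @: [set: 'S_5].
  by rewrite (Aut_sigE (coded_plusP 1)) Aut_neg_nil conjsg1.
split; first exact: A.
by rewrite -A; apply: (SwAut_eps_bar (coded_plusP 1)); vm_compute.
Qed.

Lemma perm_D8_conj (t : 'S_5) :
  <<[set tperm (t o0) (t o1); cyc4 (t o0) (t o2) (t o1) (t o3)]>> = perm_D8 :^ t.
Proof. by rewrite -genJ conjUg !conjg_set1 tperm_conj cyc4_conj. Qed.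

Lemma AutE_P1 t :
  Aut_sig (sigP1 t) = pact @: (perm_D8 :^ t) /\
  SwAut_sig (sigP1 t) = eps_bar (pact @: (perm_D8 :^ t)).
Proof.
have A := Aut_sigE (coded_P1 t); rewrite Aut_negP1 in A; split; first exact: A.
by rewrite -A; apply: (SwAut_eps_bar (coded_P1 t)); vm_compute.
Qed.

Lemma AutE_P23 t :
  Aut_sig (sigP23 t) = pact @: (perm_D8 :^ t) /\
  SwAut_sig (sigP23 t) = eps_bar (pact @: (perm_D8 :^ t)).
Proof.
have A := Aut_sigE (coded_P23 t); rewrite Aut_negP23 in A; split; first exact: A.
by rewrite -A; apply: (SwAut_eps_bar (coded_P23 t)); vm_compute.
Qed.

Lemma tperm2_conj (t : 'S_5) a b c d :
  tperm (t a) (t b) * tperm (t c) (t d) = (tperm a b * tperm c d) ^ t.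
Proof. by rewrite conjMg !tpermJ. Qed.

Definition swap_jl_km (t : 'S_5) : coset_of pmeps :=
  bar (zeta [set vtx (t o1) (t o4); vtx (t o2) (t o3)])
    (pact (tperm (t o1) (t o3) * tperm (t o2) (t o4))).

Definition swap_jl_km_zeta p := eqp p (o1, o4) || eqp p (o2, o3).

(** Kept general in L because the same element serves two edges at distance 2 and the alternating
    hexagon. *)
Lemma swap_jl_km_SwAut sg t L : coded sg t L ->
  sw_ok swap_jl_km_zeta L (ccomp (ctperm o1 o3) (ctperm o2 o4)) ->
  swap_jl_km t \in SwAut_sig sg.
Proof.
move=> cd ok; apply: bar_SwAut; apply: (coded_swstab cd) => [p hp|].
  rewrite ffunE in_set2 -/(vlab t (o1, o4)) -/(vlab t (o2, o3)).
  by rewrite !eq_vlab ?(vpair_pairs hp).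
by rewrite tperm2_conj conjgK codeM !code_tperm; apply: ok.
Qed.

Lemma Aut_eps_SwAut sg a : a \in Aut_sig sg -> bar eps a \in SwAut_sig sg.
Proof. by rewrite Aut_swstab => /bar_SwAut. Qed.

(** The two listed elements are switching automorphisms, and their projections generate the
    conjugate of [perm_V4] that bounds the projection by the 5-cycle test. *)
Lemma AutE_P22 t :
  [/\ Aut_sig (sigP22 t) = pact @: (<<[set tperm o1 o2 * tperm o3 o4]>> :^ t),
      SwAut_sig (sigP22 t) = <<[set bar eps (pact (tperm (t o1) (t o2) *
        tperm (t o3) (t o4))); swap_jl_km t]>> &
      pA @: SwAut_sig (sigP22 t) = pact @: (perm_V4 :^ t)].
Proof.
have A := Aut_sigE (coded_P22 t); rewrite Aut_negP22 in A.
pose x := tperm o1 o2 * tperm o3 o4; pose y := tperm o1 o3 * tperm o2 o4.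
pose X : {set coset_of pmeps} := [set bar eps (pact (x ^ t)); swap_jl_km t].
have sX : X \subset SwAut_sig (sigP22 t).
  apply/subsetP=> _ /set2P[]->; last first.
    by apply: (swap_jl_km_SwAut (coded_P22 t)); vm_compute.
  apply: Aut_eps_SwAut; rewrite A imset_f // mem_conjg conjgK.
  exact/mem_gen/set11.
have eX : pA @: X = pact @: ([set x; y] :^ t).
  by rewrite conjUg !conjg_set1 !imsetU !imset_set1 !pA_bar /swap_jl_km tperm2_conj.
have sB u : u \in SwAut_sig (sigP22 t) -> pA u \in pact @: <<[set x; y] :^ t>>.
  case/(SwAut_pent (coded_P22 t)) => s -> hs; apply: imset_f.
  by rewrite genJ -/perm_V4 -pent_negP22 conj_codes.
have E := SwAut_gen sX eX sB.
split=> //; first by rewrite tperm2_conj.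
rewrite E -(morphimEsub pA_morphism) ?subsetT // morphim_gen ?subsetT //.
rewrite morphimEsub ?subsetT // eX -morphimEsub ?subsetT // -morphim_gen ?subsetT //.
by rewrite morphimEsub ?subsetT // genJ.
Qed.

Lemma Alt_conj (t : 'S_5) : 'Alt_('I_5) :^ t = 'Alt_('I_5).
Proof. by apply/normP/(subsetP (Alt_norm _)); rewrite inE. Qed.

(** The 5-cycle test excludes odd permutations. Conversely each generator of the alternating group
    lifts, the first two with trivial switching and the third to [swap_jl_km]. *)
Lemma AutE_P32 t :
  Aut_sig (sigP32 t) = pact @: (perm_S3 :^ t) /\
  pA @: SwAut_sig (sigP32 t) = pact @: 'Alt_('I_5).
Proof.
have A := Aut_sigE (coded_P32 t); rewrite Aut_negP32 in A; split=> //.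
apply/eqP; rewrite eqEsubset; apply/andP; split.
  apply/subsetP=> _ /imsetP[u /(SwAut_pent (coded_P32 t))[s -> /pent_negP32 hs] ->].
  by rewrite imset_f // -(Alt_conj t) mem_conjg.
(* Normality of the alternating group allows its generators to be taken in the labelling t. *)
rewrite -(Alt_conj t) Alt_gens -genJ -morphimEsub ?subsetT // morphim_gen ?subsetT //.
rewrite -(morphimEsub pA_morphism) ?subsetT // gen_subG morphimEsub ?subsetT //.
apply/subsetP=> _ /imsetP[_ /imsetP[g + ->] ->].
rewrite !inE.
have inSw z a : bar z a \in SwAut_sig (sigP32 t) ->
    a \in (pA_morphism @* SwAut_sig_group (sigP32 t))%G.
  move=> h; rewrite /= morphimEsub ?subsetT //; apply/imsetP.
  by exists (bar z a); [exact: h | exact: (esym (pA_bar z a))].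
case/or3P=> /eqP->.
- apply: (inSw eps); apply: Aut_eps_SwAut; rewrite A imset_f // mem_conjg conjgK.
  exact/mem_gen/set21.
- apply: (inSw eps); apply: Aut_eps_SwAut; rewrite A imset_f // mem_conjg conjgK.
  exact/mem_gen/set22.
rewrite -tperm2_conj; apply: inSw (swap_jl_km_SwAut (coded_P32 t) _);
  by vm_compute.
Qed.

(** * Groups given by symmetric groups on sets of letters *)

Lemma mem_SymOn (X : {set 'I_5}) (s : 'S_5) :
  reflect (forall a, a \notin X -> s a = a) (s \in SymOn X).
Proof.
rewrite inE; apply: (iffP subsetP) => h a.
  by move=> aX; apply/eqP; apply: contraR aX => /h.
by apply: contraTT => /h e; rewrite inE e eqxx.
Qed.

Lemma SymOn4 (t : 'S_5) :
  SymOn [set t o0; t o1; t o2; t o3] = [set s : 'S_5 | s (t o4) == t o4].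
Proof.
apply/setP=> s; rewrite [RHS]inE; apply/mem_SymOn/eqP => [|e a].
  by apply; rewrite !inE !(inj_eq perm_inj).
rewrite -(permKV t a) !inE !(inj_eq perm_inj).
have := mem_o5 (t^-1 a); rewrite !inE.
by do 4!case: eqP => //= _; move/eqP->.
Qed.

Lemma SymOn4_conj (t : 'S_5) :
  SymOn [set t o0; t o1; t o2; t o3] = Aut_neg negP33 :^ t.
Proof.
rewrite SymOn4 Aut_negP33; apply/setP=> s; rewrite mem_conjg !inE.
by rewrite conjgE invgK !permM (canF_eq (permKV t)).
Qed.

(** The setwise stabilizer of {[o3], [o4]} consists of [perm_S3], which is even, and its coset by
    the transposition of these letters, which is odd. *)
Lemma stab34 (s : 'S_5) : s o3 \in [:: o3; o4] -> s o4 \in [:: o3; o4] ->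
  ~~ odd_perm s -> s \in perm_S3.
Proof.
move=> h3 h4 es.
pose c := [:: ccomp (ctperm o0 o1) (ctperm o3 o4);
              ccomp (ctperm o1 o2) (ctperm o3 o4)].
pose gs : seq 'S_5 := [:: tperm o0 o1 * tperm o3 o4; tperm o1 o2 * tperm o3 o4].
have gsc : map code gs = c by code_gens.
have gsA : all (fun g => g \in 'Alt_('I_5)) gs.
  by rewrite /= !Alt_even !odd_permM !odd_tperm.
have S3E : perm_S3 = <<[set g in gs]>>.
  by congr generated; apply/setP=> g; rewrite !inE.
have /all_codes/(_ s)/implyP : all (fun x =>
    (capp x o3 \in [:: o3; o4]) && (capp x o4 \in [:: o3; o4]) ==>
    (x \in words 5 c) || (ccomp x (ctperm o3 o4) \in words 5 c)) codes by vm_compute.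
rewrite !capp_code h3 h4 => /(_ isT)/orP[/(even_words gsc gsA)[]|].
  by rewrite S3E.
rewrite -code_tperm -codeM => /(even_words gsc gsA)[_].
by rewrite Alt_even odd_permM odd_tperm addbT es.
Qed.

(** The internal product [\x] is the expected set only for commuting factors with trivial
    intersection, so these two facts come first. *)
Lemma even_part_conj (t : 'S_5) :
  even_part (SymOn [set t o0; t o1; t o2] \x SymOn [set t o3; t o4]) =
  perm_S3 :^ t.
Proof.
set X := [set t o0; t o1; t o2]; set Y := [set t o3; t o4].
pose A := perm.Sym_group X; pose B := perm.Sym_group Y.
have XY a : a \in X -> a \in Y = false.
  rewrite -(permKV t a) !inE !(inj_eq perm_inj).
  by rewrite -orbA => /or3P[] /eqP->.
have fixA s : s \in A -> {in Y, forall a, s a = a}.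
  by move=> /mem_SymOn h a aY; apply: h; apply: contraL aY => /XY->.
have fixB s : s \in B -> {in X, forall a, s a = a}.
  by move=> /mem_SymOn h a aX; apply: h; rewrite XY.
have XYT a : a \notin Y -> a \in X.
  rewrite -(permKV t a) !inE !(inj_eq perm_inj).
  by have := mem_o5 (t^-1 a); rewrite !inE; do 5!case: eqP.
have stabA s a : s \in A -> a \in X -> s a \in X.
  move=> sA aX; apply: XYT; apply/negP=> sY.
  by have := XY _ aX; rewrite -(perm_inj (fixA s sA _ sY)) sY.
have cAB : B \subset 'C(A).
  apply/centsP=> r rB s sA; apply/permP=> a; rewrite !permM.
  have [aY|/XYT aX] := boolP (a \in Y); last first.
    by rewrite (fixB r rB a aX) (fixB r rB _ (stabA s a sA aX)).
  have rY : r a \in Y.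
    apply: contraLR aY => /XYT raX; have := fixB r rB _ raX => /perm_inj raE.
    by rewrite -raE XY.
  by rewrite (fixA s sA a aY) (fixA s sA _ rY).
have tiAB : A :&: B = 1.
  apply/trivgP/subsetP=> s /setIP[sA sB]; rewrite inE; apply/eqP/permP=> a.
  rewrite perm1; have [aY|/XYT aX] := boolP (a \in Y); first exact: fixA sA a aY.
  exact: fixB sB a aX.
have dE : SymOn X \x SymOn Y = A <*> B by apply: (@dprodEY _ A B).
have mE : A <*> B = A * B by apply: cent_joinEr.
have eE : even_part (A <*> B) = (A <*> B) :&: 'Alt_('I_5).
  by apply/setP=> s; rewrite [LHS]in_set in_setI Alt_even.
rewrite dE eE; apply/eqP; rewrite eqEsubset; apply/andP; split.
  (* An element of the product preserves Y setwise; being even, it falls under [stab34] after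
     conjugation. *)
  apply/subsetP=> s /setIP[]; rewrite mE Alt_even => sAB es.
  have sY a : a \in Y -> s a \in Y.
    case/mulsgP: sAB => u w uA wB ->; rewrite permM => aY.
    rewrite (fixA u uA a aY); apply: contraLR aY => /XYT waX.
    by have /perm_inj waE := fixB w wB _ waX; rewrite -waE XY.
  have s34 a : t a \in Y -> (s ^ t^-1) a \in [:: o3; o4].
    move=> /sY; rewrite conjgE invgK !permM -{1}(permKV t (s (t a))).
    by rewrite !inE !(inj_eq perm_inj).
  rewrite mem_conjg; apply: stab34; rewrite ?odd_permJ //; apply: s34.
    exact: set21.
  exact: set22.
rewrite -genJ -[_ :&: _]/(gval [group of (A <*> B) :&: 'Alt_('I_5)]) gen_subG.
have tA a b : t a \in X -> t b \in X -> tperm (t a) (t b) \in A.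
  move=> aX bX; apply/mem_SymOn=> c cX; apply: tpermD.
    by apply: contraNneq cX => <-.
  by apply: contraNneq cX => <-.
have tB : tperm (t o3) (t o4) \in B.
  apply/mem_SymOn=> c; rewrite !inE negb_or => /andP[c3 c4].
  by apply: tpermD; rewrite eq_sym.
(* Each generator is a transposition within X times the transposition of Y, hence even. *)
have gen_in a b : t a \in X -> t b \in X -> a != b ->
    tperm (t a) (t b) * tperm (t o3) (t o4) \in (A <*> B) :&: 'Alt_('I_5).
  move=> aX bX ab; rewrite in_setI Alt_even odd_permM !odd_tperm.
  by rewrite !(inj_eq perm_inj) ab andbT mE mem_mulg ?tA.
rewrite conjUg !conjg_set1 -!tperm2_conj subUset !sub1set.
by rewrite !gen_in // !inE eqxx ?orbT.
Qed.

(** The stabilizer of m and its cosets by the transpositions (pm) fill the symmetric group.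
    Switching at $N[v_{pm}]$ lifts each (pm), so the listed union projects onto everything and
    injectivity of [pA] gives equality. *)
Lemma AutE_P33 (t : 'S_5) (G := pact @: SymOn [set t o0; t o1; t o2; t o3]) :
  [/\ Aut_sig (sigP33 t) = G,
      SwAut_sig (sigP33 t) = eps_bar G :|:
        \bigcup_(p in [set t o0; t o1; t o2; t o3])
          (bar (zeta (closed_nbhd (vtx p (t o4)))) (pact (tperm p (t o4)))
             *: eps_bar G) &
      pA @: SwAut_sig (sigP33 t) = pact @: [set: 'S_5]].
Proof.
have A : Aut_sig (sigP33 t) = G by rewrite (Aut_sigE (coded_P33 t)) -SymOn4_conj.
have sE : eps_bar G \subset SwAut_sig (sigP33 t).
  by apply/subsetP=> _ /imsetP[a + ->]; rewrite -A; apply: Aut_eps_SwAut.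
pose b p := bar (zeta (closed_nbhd (vtx p (t o4)))) (pact (tperm p (t o4))).
have sb p : p \in [set t o0; t o1; t o2; t o3] -> b p \in SwAut_sig (sigP33 t).
  have sb' a : a \in [:: o0; o1; o2; o3] -> b (t a) \in SwAut_sig (sigP33 t).
    move=> ha; apply: bar_SwAut.
    pose zc a q := eqp q (a, o4) || disj (a, o4) q.
    apply: (coded_swstab (zc := zc a) (coded_P33 t)).
      move=> q /vpair_pairs hq; rewrite ffunE inE -/(vlab t (a, o4)).
      have pa : vpair (a, o4) by move: ha; rewrite !inE => /or4P[] /eqP->.
      by rewrite eq_vlab ?adj_vlab.
    rewrite tperm_conj conjgK code_tperm.
    have /allP/(_ a ha) : all (fun a => sw_ok (zc a) negP33 (ctperm a o4))
      [:: o0; o1; o2; o3] by vm_compute.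
    exact.
  by rewrite !inE -!orbA => /or4P[] /eqP->; apply: sb'.
set U := _ :|: _.
have sU : U \subset SwAut_sig (sigP33 t).
  rewrite subUset sE; apply/bigcupsP=> p /sb bp.
  apply/subsetP=> _ /lcosetP[y hy ->]; apply: groupM => //.
  exact: (subsetP sE).
have allU s : exists2 y, y \in U & pA y = pact s.
  have [e|ne] := eqVneq (s (t o4)) (t o4).
    exists (bar eps (pact s)); last exact: pA_bar.
    by rewrite inE; apply/orP; left; do 2!apply: imset_f; rewrite SymOn4 inE e.
  (* As s sends p to m, the product of (pm) and s fixes m. *)
  pose p := s^-1 (t o4).
  have hp : p \in [set t o0; t o1; t o2; t o3].
    have : p != t o4 by apply: contraNneq ne => e; rewrite -{1}e permKV.
    rewrite /p -(permKV t (s^-1 _)) !inE !(inj_eq perm_inj).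
    have := mem_o5 (t^-1 (s^-1 (t o4))); rewrite !inE.
    by do 4!case: eqP => //= _; move->.
  exists (b p * bar eps (pact (tperm p (t o4) * s))); last first.
    by rewrite pAM !pA_bar -pactM mulgA tperm2 mul1g.
  rewrite inE; apply/orP; right; apply/bigcupP; exists p => //.
  rewrite mem_lcoset mulKg; do 2!apply: imset_f.
  by rewrite SymOn4 inE permM tpermR permKV.
split=> //.
  apply/eqP; rewrite eqEsubset sU andbT; apply/subsetP=> x hx.
  have [z [s [ex _]]] := SwAutP hx; have [y hy ey] := allU s.
  by rewrite (pA_inj hx (subsetP sU _ hy)) ?hy // ey ex pA_bar.
apply/setP=> a; apply/imsetP/imsetP=> [[x /SwAutP[z [s [-> _]]] ->]|[s _ ->]].
  by exists s; rewrite ?pA_bar.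
by have [y hy ey] := allU s; exists y; rewrite ?(subsetP sU).
Qed.

(** * Labelling the minimal signatures *)

Definition edges := [seq (p, q) | p <- pairs, q <- nbrs p].

Lemma edge_codes (e : edge) t :
  exists2 c, c \in edges & eset e = [set vlab t c.1; vlab t c.2].
Proof.
case: e => e /= /is_edgeP[u [w [+ ->]]].
have [[p hp ->] [q hq ->]] := (vlab_surj t u, vlab_surj t w).
rewrite adj_vlab ?vpair_pairs // => pq; exists (p, q) => //.
by apply/allpairsPdep; exists p, q; rewrite mem_nbrs.
Qed.

Lemma vpair_edges c : c \in edges -> vpair c.1 /\ vpair c.2.
Proof.
by case/allpairsPdep=> p [q [/vpair_pairs hp]]; rewrite mem_filter =>
  /andP[_ /vpair_pairs hq] ->.
Qed.

Definition eqe_map x (c : ('I_5 * 'I_5) * ('I_5 * 'I_5)) a b :=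
  eqe c (mapp x a, mapp x b).

Lemma eqe_mapP t c a b : c \in edges -> vpair a -> vpair b ->
  eqe_map (code t) c a b -> [set vlab 1 c.1; vlab 1 c.2] = [set vlab t a; vlab t b].
Proof.
move=> /vpair_edges[c1 c2] ha hb h; rewrite (vlab_code t a) (vlab_code t b).
by apply/eqP; rewrite eq_set2 !eq_vlab ?vpair_mapp.
Qed.

Lemma is_P1_sig tau : is_P1 tau -> exists t, tau = sigP1 t.
Proof.
case=> e ->; have [c hc ->] := edge_codes e 1.
have /allP/(_ c hc)/has_codes[t h] : all (fun c => has (fun x =>
    eqe_map x c (o0, o1) (o2, o3)) codes) edges by vm_compute.
by exists t; rewrite (eqe_mapP hc _ _ h).
Qed.

(** Equal edges or a shared end would give a path of length 0 or 1 in the line graph. *)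
Lemma edge_dist_disjoint e f n x : edge_dist e f n.+2 ->
  x \in eset e -> x \notin eset f.
Proof.
case=> _ h xe; apply/negP=> xf.
have [e_f|nef] := eqVneq e f; first by have := h [::] isT e_f.
suff ef : line_adj e f by have := h [:: f]; rewrite /= ef => /(_ isT erefl).
by rewrite /line_adj nef; apply/set0Pn; exists x; rewrite inE xe.
Qed.

Lemma edge_set2 (e : edge) x : x \in eset e ->
  exists2 y, adj x y & eset e = [set x; y].
Proof.
case: e => e /= /is_edgeP[u [w [uw ->]]] /set2P[]->; first by exists w.
by exists u; rewrite ?(adj_sym w) // setUC.
Qed.

(** The middle edge of a shortest path joins an end x of e to an end y of f, and the four ends form
    a 3-arc u, x, y, w to which [three_arc] applies. *)
Lemma is_P22_sig tau : is_P22 tau -> exists t, tau = sigP22 t.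
Proof.
case=> e [f [-> d]]; have [[r [+ + sr]] _] := d.
case: r sr => [|g [|h [|? ?]]] //= _ + hf; rewrite {h}hf andbT.
case/andP=> /andP[_ /set0Pn[x /setIP[xe xg]]] /andP[_ /set0Pn[y /setIP[yg yf]]].
have xf := edge_dist_disjoint d xe.
have xy : x != y by apply: contraNneq xf => ->.
have [u xu Ee] := edge_set2 xe; have [w yw Ef] := edge_set2 yf.
have axy : adj x y.
  have [z xz Eg] := edge_set2 xg; move: yg; rewrite Eg.
  by case/set2P=> [e'|-> //]; rewrite e' eqxx in xy.
have uy : u != y.
  apply: contraTneq yf => <-; apply: (edge_dist_disjoint d).
  by rewrite Ee set22.
have xw : x != w by apply: contraNneq xf => ->; rewrite Ef set22.
rewrite adj_sym in xu.
have [t [eu ex ey ew]] := three_arc xu axy yw uy xw.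
by exists t; rewrite Ee Ef (setUC [set x]) eu ex ey ew.
Qed.

(** An edge xy would give a line-graph path of length 2 from e to f. *)
Lemma edge_dist3_nonadj e f x y : edge_dist e f 3 -> x \in eset e -> y \in eset f ->
  (x != y) && ~~ adj x y.
Proof.
move=> d xe yf; have xf := edge_dist_disjoint d xe.
rewrite (contraNneq _ xf) => [|->] //=; apply/negP=> xy.
pose g := Edge (adj_is_edge xy).
have ye : y \notin eset e by apply: contraTN yf => /(edge_dist_disjoint d).
have eg : line_adj e g.
  apply/andP; split; first by apply: contraNneq ye => ->; rewrite set22.
  by apply/set0Pn; exists x; rewrite inE xe set21.
have gf : line_adj g f.
  apply/andP; split; first by apply: contraNneq xf => <-; rewrite set21.
  by apply/set0Pn; exists y; rewrite inE yf set22.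
by case: d => _ /(_ [:: g; f]); rewrite /= eg gf => /(_ isT erefl).
Qed.

Definition nonadj p q := ~~ eqp p q && ~~ disj p q.

Definition nonadj_edge (e f : ('I_5 * 'I_5) * ('I_5 * 'I_5)) :=
  [&& nonadj e.1 f.1, nonadj e.1 f.2, nonadj e.2 f.1 & nonadj e.2 f.2].

Lemma dist3_codes e f c d : c \in edges -> d \in edges ->
  eset e = [set vlab 1 c.1; vlab 1 c.2] -> eset f = [set vlab 1 d.1; vlab 1 d.2] ->
  edge_dist e f 3 -> nonadj_edge c d.
Proof.
move=> /vpair_edges[c1 c2] /vpair_edges[d1 d2] Ee Ef /edge_dist3_nonadj nadj.
rewrite /nonadj_edge /nonadj -!(eq_vlab 1) // -!(adj_vlab 1) //.
by rewrite !nadj // ?Ee ?Ef ?set21 ?set22.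
Qed.

Lemma is_P23_sig tau : is_P23 tau -> exists t, tau = sigP23 t.
Proof.
case=> e [f [-> d]].
have [[c hc Ee] [c' hc' Ef]] := (edge_codes e 1, edge_codes f 1).
have /allP/(_ c hc)/allP/(_ c') : all (fun c => all (fun c' => has (fun x =>
    eqe_map x c (o0, o2) (o1, o3) && eqe_map x c' (o0, o3) (o1, o2)) codes)
    [seq c' <- edges | nonadj_edge c c']) edges by vm_compute.
rewrite mem_filter hc' (dist3_codes hc hc' Ee Ef) // => /(_ isT)/has_codes[t].
case/andP=> h h'; exists t.
by rewrite Ee Ef (eqe_mapP hc _ _ h) // (eqe_mapP hc' _ _ h').
Qed.

Lemma is_P33_sig tau : is_P33 tau -> exists t, tau = sigP33 t.
Proof.
case=> e [f [g [-> [def deg dfg]]]].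
have [[c hc Ee] [c' hc' Ef]] := (edge_codes e 1, edge_codes f 1).
have [c'' hc'' Eg] := edge_codes g 1.
have /allP/(_ c hc)/allP/(_ c') : all (fun c => all (fun c' => all (fun c'' =>
    has (fun x => [&& eqe_map x c (o0, o1) (o2, o3), eqe_map x c' (o0, o2) (o1, o3) &
      eqe_map x c'' (o0, o3) (o1, o2)]) codes)
    [seq c'' <- [seq d <- edges | nonadj_edge c d] | nonadj_edge c' c''])
    [seq c' <- edges | nonadj_edge c c']) edges by vm_compute.
rewrite mem_filter hc' (dist3_codes hc hc' Ee Ef) // => /(_ isT)/allP/(_ c'').
rewrite !mem_filter hc'' (dist3_codes hc hc'' Ee Eg) //
  (dist3_codes hc' hc'' Ef Eg) //.
move/(_ isT)/has_codes=> [t /and3P[h h' h'']]; exists t.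
by rewrite Ee Ef Eg (eqe_mapP hc _ _ h) // (eqe_mapP hc' _ _ h') //
  (eqe_mapP hc'' _ _ h'').
Qed.

(** The first four vertices of the hexagon form a 3-arc. Once they carry the model labels, the other
    two vertices are forced to be $v_{jl}$ and $v_{km}$. *)
Lemma is_P32_sig tau : is_P32 tau -> exists t, tau = sigP32 t.
Proof.
case=> a [b [c [d [e [f [/andP[]]]]]]].
rewrite /= !inE !negb_or !andbT.
case/and5P=> ab bc cd de /andP[ef fa].
case/and5P=> /and5P[_ ac _ _ _] /and4P[_ bd _ bf] /and3P[_ ce _] _ _ ->.
have [t [ea eb ec ed]] := three_arc ab bc cd ac bd; exists t.
have [[p hp eE] [q hq fE]] := (vlab_surj t e, vlab_surj t f).
move: de ef fa bf ce; rewrite ea eb ec ed eE fE.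
rewrite !adj_vlab ?(vpair_pairs hp) ?(vpair_pairs hq) //.
rewrite !eq_vlab ?(vpair_pairs hp) ?(vpair_pairs hq) // => de ef fa bf ce.
have /allP/(_ p hp)/allP/(_ q hq) : all (fun p => all (fun q =>
    [&& disj (o0, o4) p, disj p q, disj q (o0, o3), ~~ eqp (o1, o4) q &
      ~~ eqp (o2, o3) p] ==> eqp p (o1, o3) && eqp q (o2, o4)) pairs) pairs.
  by vm_compute.
rewrite de ef fa bf ce -!(eq_vlab t) ?(vpair_pairs hp) ?(vpair_pairs hq) //.
by case/andP=> /eqP-> /eqP->.
Qed.

(** * Transfer of the isomorphism types to the signatures *)

Lemma isog_pact_conj (rT : finGroupType) (H : {group 'S_5}) (K : {group rT}) t :
  H \isog K -> pact @: (H :^ t) \isog K.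
Proof.
move=> HK.
have e : pact_morphism @* (H :^ t) = pact @: (H :^ t).
  by rewrite morphimEsub ?subsetT.
have := pact_isog H t; rewrite -e isog_sym => h.
exact: (isog_trans h HK).
Qed.

Lemma isog_SwAut (rT : finGroupType) (H : {group 'S_5}) (K : {group rT}) sg t :
  pA @: SwAut_sig sg = pact @: (H :^ t) -> H \isog K -> SwAut_sig sg \isog K.
Proof.
move=> e HK; have := SwAut_isog sg; rewrite e.
have e' : pact_morphism @* (H :^ t) = pact @: (H :^ t).
  by rewrite morphimEsub ?subsetT.
have := isog_pact_conj t HK; rewrite -e' => h1 h2.
exact: (isog_trans h2 h1).
Qed.

Lemma isog_plusP :
  Aut_sig plusP \isog [set: 'S_5] /\ SwAut_sig plusP \isog [set: 'S_5].
Proof.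
have [eA eS] := AutE_plusP.
have h : pact @: [set: 'S_5] \isog [set: 'S_5].
  by have := isog_pact_conj 1 (isog_refl [set: 'S_5]%G); rewrite conjsg1.
split; first by rewrite eA.
by apply: (@isog_SwAut _ setT setT _ 1); rewrite ?isog_refl // eS pA_eps_bar conjsg1.
Qed.

Lemma isog_P1 t : Aut_sig (sigP1 t) \isog 'D_8 /\ SwAut_sig (sigP1 t) \isog 'D_8.
Proof.
have [eA eS] := AutE_P1 t.
split; first by rewrite eA; apply: isog_pact_conj D8_isog.
by apply: (isog_SwAut _ D8_isog); rewrite eS pA_eps_bar.
Qed.

Lemma isog_P23 t : Aut_sig (sigP23 t) \isog 'D_8 /\ SwAut_sig (sigP23 t) \isog 'D_8.
Proof.
have [eA eS] := AutE_P23 t.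
split; first by rewrite eA; apply: isog_pact_conj D8_isog.
by apply: (isog_SwAut _ D8_isog); rewrite eS pA_eps_bar.
Qed.

Lemma isog_P22 t :
  Aut_sig (sigP22 t) \isog Zp 2 /\ SwAut_sig (sigP22 t) \isog setX (Zp 2) (Zp 2).
Proof.
have [eA _ eS] := AutE_P22 t.
split; first by rewrite eA; apply: isog_pact_conj Z2_isog.
by apply: (isog_SwAut eS V4_isog).
Qed.

Lemma isog_P32 t :
  Aut_sig (sigP32 t) \isog [set: 'S_3] /\ SwAut_sig (sigP32 t) \isog 'Alt_('I_5).
Proof.
have [eA eS] := AutE_P32 t.
split; first by rewrite eA; apply: isog_pact_conj S3_isog.
by apply: (@isog_SwAut _ _ _ _ 1 _ (isog_refl _)); rewrite conjsg1.
Qed.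

Lemma isog_P33 t :
  Aut_sig (sigP33 t) \isog [set: 'S_4] /\ SwAut_sig (sigP33 t) \isog [set: 'S_5].
Proof.
have [eA _ eS] := AutE_P33 t; split; last first.
  by apply: (@isog_SwAut _ setT setT _ 1); rewrite ?isog_refl // eS conjsg1.
(* Writing the stabilizer of [o4] as a [Sym_group] supplies the group structure that
   [isog_pact_conj] requires. *)
have E1 :
    perm.Sym_group [set o0; o1; o2; o3] = [set s : 'S_5 | s o4 == o4] :> {set _}.
  by have := SymOn4 1; rewrite !perm1.
rewrite eA SymOn4_conj Aut_negP33 -E1; apply: isog_pact_conj; exact: S4_isog.
Qed.

Lemma uniq_perm5 i j k l m : uniq [:: i; j; k; l; m] ->
  exists t : 'S_5, [/\ i = t o0, j = t o1, k = t o2, l = t o3 & m = t o4].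
Proof.
move=> u; have /codeP[t [<- <- <- <- <-]] : [:: i; j; k; l; m] \in codes.
  exact: mem_codes.
by exists t.
Qed.

Theorem theorem8p13 :
  (* abstract isomorphism types *)
  [/\ (forall sg, pmsig plusP sg ->
         Aut_sig sg \isog [set: 'S_5] /\ SwAut_sig sg \isog [set: 'S_5]),
      (forall tau sg, is_P1 tau -> pmsig tau sg ->
         Aut_sig sg \isog 'D_8 /\ SwAut_sig sg \isog 'D_8),
      (forall tau sg, is_P22 tau -> pmsig tau sg ->
         Aut_sig sg \isog Zp 2 /\ SwAut_sig sg \isog setX (Zp 2) (Zp 2)),
      (forall tau sg, is_P23 tau -> pmsig tau sg ->
         Aut_sig sg \isog 'D_8 /\ SwAut_sig sg \isog 'D_8) &
      (forall tau sg, is_P32 tau -> pmsig tau sg ->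
         Aut_sig sg \isog [set: 'S_3] /\ SwAut_sig sg \isog 'Alt_('I_5)) /\
      (forall tau sg, is_P33 tau -> pmsig tau sg ->
         Aut_sig sg \isog [set: 'S_4] /\ SwAut_sig sg \isog [set: 'S_5])]
  /\
  (* explicit descriptions *)
  forall i j k l m : 'I_5, uniq [:: i; j; k; l; m] ->
  let v := vtx in
  [/\ (* (1) *)
      (forall sg, pmsig plusP sg ->
         Aut_sig sg = pact @: [set: 'S_5] /\
         SwAut_sig sg = eps_bar (pact @: [set: 'S_5])),
      (* (2) *)
      (forall sg, pmsig (sigP [set [set v i j; v k l]]) sg ->
         let G := pact @: <<[set tperm i j; cyc4 i k j l]>> in
         Aut_sig sg = G /\ SwAut_sig sg = eps_bar G),
      (* (3) *)
      (forall sg,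
         pmsig (sigP [set [set v i l; v j m]; [set v k l; v i m]]) sg ->
         Aut_sig sg = pact @: <<[set tperm j k * tperm l m]>> /\
         SwAut_sig sg =
           <<[set bar eps (pact (tperm j k * tperm l m));
                  bar (zeta [set v j m; v k l])
                      (pact (tperm j l * tperm k m))]>>),
      (* (4) *)
      (forall sg,
         pmsig (sigP [set [set v i k; v j l]; [set v i l; v j k]]) sg ->
         let G := pact @: <<[set tperm i j; cyc4 i k j l]>> in
         Aut_sig sg = G /\ SwAut_sig sg = eps_bar G) &
      (* (5) *)
      (forall sg,
         pmsig (sigP [set [set v i l; v j m]; [set v k l; v i m];
                          [set v j l; v k m]]) sg ->
         Aut_sig sg =
           pact @: even_part (SymOn [set i; j; k] \x SymOn [set l; m]) /\
         pA @: SwAut_sig sg = pact @: 'Alt_('I_5)) /\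
      (* (6) *)
      (forall sg,
         pmsig (sigP [set [set v i j; v k l]; [set v i k; v j l];
                          [set v i l; v j k]]) sg ->
         let G := pact @: SymOn [set i; j; k; l] in
         Aut_sig sg = G /\
         SwAut_sig sg =
           eps_bar G :|:
           \bigcup_(p in [set i; j; k; l])
             (bar (zeta (closed_nbhd (v p m))) (pact (tperm p m)) *:
              eps_bar G))].
Proof.
split.
  split.
  - by move=> sg /pmsigE[-> ->]; apply: isog_plusP.
  - by move=> tau sg /is_P1_sig[t ->] /pmsigE[-> ->]; apply: isog_P1.
  - by move=> tau sg /is_P22_sig[t ->] /pmsigE[-> ->]; apply: isog_P22.
  - by move=> tau sg /is_P23_sig[t ->] /pmsigE[-> ->]; apply: isog_P23.
  split.
  - by move=> tau sg /is_P32_sig[t ->] /pmsigE[-> ->]; apply: isog_P32.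
  by move=> tau sg /is_P33_sig[t ->] /pmsigE[-> ->]; apply: isog_P33.
move=> i j k l m /uniq_perm5[t [-> -> -> -> ->]] v; split.
- by move=> sg /pmsigE[-> ->]; apply: AutE_plusP.
- by move=> sg /pmsigE[-> ->] G; rewrite /G perm_D8_conj; apply: AutE_P1.
- move=> sg /pmsigE[-> ->]; have [eA eS _] := AutE_P22 t.
  by rewrite [Aut_sig _]eA [SwAut_sig _]eS tperm2_conj -conjg_set1 genJ.
- by move=> sg /pmsigE[-> ->] G; rewrite /G perm_D8_conj; apply: AutE_P23.
split.
- by move=> sg /pmsigE[-> ->]; rewrite even_part_conj; apply: AutE_P32.
by move=> sg /pmsigE[-> ->] G; have [] := AutE_P33 t.
Qed.
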